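(* Let $\mathcal E$ be a nonlinear order preserving form on $L^2(\mu)$. The following are equivalent: (i) there exists a measurable $g\colon X\to(0,\infty)$ with $Gg<\infty$ $\mu$-a.e.; (ii) there exists a measurable $w\colon X\to(0,\infty)$ such that $\int_X|f|w\,d\mu\le\|f\|_L$ for all $f\in M(\mathcal E)$. If $\mathcal E_e$ exists, then the inequality in (ii) extends to all $f\in M(\mathcal E_e)$ with $\|\cdot\|_L$ replaced by $\|\cdot\|_{L_e}$.
   Context: $(X,\mathfrak A,\mu)$ is $\sigma$-finite. A nonlinear order preserving form is a lower semicontinuous convex $\mathcal E\colon L^2(\mu)\to[0,\infty]$ with $\mathcal E(-f)=\mathcal E(f)$, $\mathcal E(0)=0$ and $\mathcal E(f+|g|)+\mathcal E(f-|g|)\le\mathcal E(f+g)+\mathcal E(f-g)$ for all $f,g$. $M(\mathcal E)=\{f:\lim_{\lambda\to0+}\mathcal E(\lambda f)=0\}$, $\|f\|_L=\inf\{\lambda>0:\mathcal E(\lambda^{-1}f)\le1\}$. Resolvent: $G_\alpha f$ is the unique minimizer of $g\mapsto\mathcal E(g)+\frac\alpha2\|g-\alpha^{-1}f\|_2^2$; extended to nonnegative measurable $[0,\infty]$-valued functions by monotone limits; Green operator $Gf=\lim_{\alpha\to0+}G_\alpha f$. $\mathcal E_e$ (if it exists) is the lower semicontinuous relaxation on $L^0(\mu)$ w.r.t. local convergence in measure of $\mathcal E$ extended by $+\infty$, existing when $\mathcal E$ is lower semicontinuous on $D(\mathcal E)$ for this convergence; $M(\mathcal E_e)$ and $\|\cdot\|_{L_e}$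 are its modular space and Luxemburg seminorm, defined as for $\mathcal E$. *)

(* Defs.v *)
From HB Require Import structures.
From mathcomp Require Import all_boot all_order all_algebra.
From mathcomp Require Import all_classical all_reals all_analysis.
Set Implicit Arguments. Unset Strict Implicit. Unset Printing Implicit Defensive.
Import Order.TTheory GRing.Theory Num.Theory.
Import numFieldNormedType.Exports.
Local Open Scope classical_set_scope.
Local Open Scope ring_scope.

Section Defs.
Context {d : measure_display} {X : measurableType d} {R : realType}
  (mu : {measure set X -> \bar R}).

Definition L2 (f : X -> R) : Prop :=
  measurable_fun setT f /\ (\int[mu]_x ((f x) ^+ 2)%:E < +oo)%E.

Definition dist2 (f g : X -> R) : \bar R := \int[mu]_x ((f x - g x) ^+ 2)%:E.

(* E : L^2(mu) -> [0,oo], represented on representatives; its values on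
   functions outside L2 are irrelevant (never used). *)
Record nonlinear_order_preserving_form (E : (X -> R) -> \bar R) : Prop := {
  nopf_ae : forall f g, L2 f -> L2 g -> {ae mu, forall x, f x = g x} -> E f = E g;
  nopf_ge0 : forall f, L2 f -> (0 <= E f)%E;
  nopf_lsc : forall (fn : nat -> X -> R) f, (forall n, L2 (fn n)) -> L2 f ->
      (fun n => dist2 (fn n) f) @ \oo --> 0%E ->
      (E f <= limn_einf (fun n => E (fn n)))%E;
  nopf_convex : forall f g (t : R), L2 f -> L2 g -> 0 <= t <= 1 ->
      (E (fun x => t * f x + (1 - t) * g x)%R <= t%:E * E f + (1 - t)%:E * E g)%E;
  nopf_sym : forall f, L2 f -> E (fun x => - f x) = E f;
  nopf_0 : E (fun _ => 0) = 0%E;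
  nopf_order : forall f g, L2 f -> L2 g ->
      (E (fun x => f x + `|g x|)%R + E (fun x => f x - `|g x|)%R
        <= E (fun x => f x + g x)%R + E (fun x => f x - g x)%R)%E
}.

Definition modular_space (D : (X -> R) -> Prop) (F : (X -> R) -> \bar R) :
    set (X -> R) :=
  [set f | D f /\ (fun l : R => F (fun x => l * f x)) @ 0^'+ --> 0%E].

(* Luxemburg (semi)norm: inf {l > 0 | F (l^-1 f) <= 1} (inf of empty = +oo). *)
Definition luxemburg (F : (X -> R) -> \bar R) (f : X -> R) : \bar R :=
  ereal_inf [set l%:E | l in [set l : R | 0 < l /\ (F (fun x => l^-1 * f x)%R <= 1)%E]].

(* g is the (unique) minimizer of h |-> E h + alpha/2 ||h - alpha^-1 f||_2^2,
   i.e. g = G_alpha f, for f in L^2. *)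
Definition is_resolvent (E : (X -> R) -> \bar R) (alpha : R) (f g : X -> R) : Prop :=
  L2 g /\ forall h, L2 h ->
    (E g + (alpha / 2)%R%:E * dist2 g (fun x => alpha^-1 * f x)%R
      <= E h + (alpha / 2)%R%:E * dist2 h (fun x => alpha^-1 * f x)%R)%E.

Definition is_resolvent_ext (E : (X -> R) -> \bar R) (alpha : R)
    (f : X -> \bar R) (u : X -> \bar R) : Prop :=
  forall (fn gn : nat -> X -> R),
    (forall n, L2 (fn n)) ->
    (forall n x, 0 <= fn n x <= fn n.+1 x) ->
    (forall x, (fun n => (fn n x)%:E) @ \oo --> f x) ->
    (forall n, is_resolvent E alpha (fn n) (gn n)) ->
    {ae mu, forall x, (fun n => (gn n x)%:E) @ \oo --> u x}.

Definition is_green (E : (X -> R) -> \bar R) (f : X -> \bar R) (v : X -> \bar R) : Prop :=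
  exists u : R -> X -> \bar R,
    (forall alpha, 0 < alpha -> is_resolvent_ext E alpha f (u alpha)) /\
    forall a : nat -> R, (forall n, 0 < a n) -> a @ \oo --> 0%R ->
      {ae mu, forall x, (fun n => u (a n) x) @ \oo --> v x}.

Definition loc_cvg_meas (fn : nat -> X -> R) (f : X -> R) : Prop :=
  forall A, measurable A -> (mu A < +oo)%E -> forall eps : R, 0 < eps ->
    (fun n => mu (A `&` [set x | eps <= `|fn n x - f x|])) @ \oo --> 0%E.

Definition extended_form_exists (E : (X -> R) -> \bar R) : Prop :=
  forall (fn : nat -> X -> R) f,
    (forall n, L2 (fn n) /\ (E (fn n) < +oo)%E) -> L2 f -> (E f < +oo)%E ->
    loc_cvg_meas fn f -> (E f <= limn_einf (fun n => E (fn n)))%E.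

(* E_e: lower semicontinuous relaxation on L^0(mu) (measurable functions)
   w.r.t. local convergence in measure of E extended by +oo outside L^2. *)
Definition extended_form (E : (X -> R) -> \bar R) (f : X -> R) : \bar R :=
  ereal_inf [set limn_einf (fun n => E (fn n)) | fn in
    [set fn : nat -> X -> R | (forall n, L2 (fn n)) /\ loc_cvg_meas fn f]].

Definition L0 (f : X -> R) : Prop := measurable_fun setT f.

End Defs.

(* Main.v *)
Require Import Defs.
From mathcomp Require Import all_boot all_order all_algebra.
From mathcomp Require Import all_classical all_reals all_analysis.
From mathcomp Require Import measurable_realfun ring lra.
Set Implicit Arguments. Unset Strict Implicit. Unset Printing Implicit Defensive.
Import Order.TTheory GRing.Theory Num.Theory.
Import numFieldNormedType.Exports.
Local Open Scope classical_set_scope.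
Local Open Scope ring_scope.

(** The resolvent [u = G_a f] is characterised by [f - a u] being a subgradient
of [E] at [u]; testing the subgradient inequalities of two resolvents at their
minimum and maximum makes [G_a f] monotone in [f] and, for [f >= 0], antitone in
[a], so that [G f] is the supremum of the [G_{1/(n+1)} f] for [f >= 0] in [L^2].
By scaling, [w] satisfies (ii) iff [int |f| w <= max 1 (E f)] on [L^2].

(i) => (ii): below [g] there is a positive [w] in [L^2] with [<w, G_a w> <= 1]
for [a = 1/(n+1)]. With [u = G_a w], the subgradient inequality at [|f|] gives
[<w, |f|> <= E f + <w, u> + a (<u, |f|> - ||u||^2)], whose last term is at most
[a ||f||^2 / 4]. As [a -> 0], [<w, |f|> <= E f + 1], and [w / 2] satisfies (ii).

(ii) => (i): for [0 <= g <= w / 2] in [L^2] and [u = G_a g] one gets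
[int |u| w <= 1 + E u <= 1 + <g, u> <= 1 + (int |u| w) / 2], so [int |u| w <= 2]
uniformly in [a], and Fatou's lemma makes the Green operator finite. The bound
[int |f| w <= max 1 (E f)] passes to [E_e] by Fatou's lemma along a.e.
convergent subsequences. *)

(** * Limits inferior and a.e. convergence *)

Section ereal_sequences.
Context {R : realType}.
Implicit Types (s t u v : (\bar R)^nat) (l : \bar R).
Local Open Scope ereal_scope.

Lemma einfs_le_limn_einf u n : einfs u n <= limn_einf u.
Proof.
rewrite limn_einf_lim (cvg_lim _ (@cvg_einfs_sup _ u))//.
by apply: ereal_sup_ubound; exists n.
Qed.

Lemma limn_einf_ge0 u : (forall n, 0 <= u n) -> 0 <= limn_einf u.
Proof.
move=> u0; apply: le_trans (einfs_le_limn_einf u 0).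
by apply: le_ereal_inf_tmp => _ [n _ <-].
Qed.

Lemma limn_einf_lt_frequently u l : limn_einf u < l ->
  forall k, exists2 n, (k <= n)%N & u n < l.
Proof.
move=> ul k; have /ereal_inf_lt[_ [n /= kn <-] unl] :=
  le_lt_trans (einfs_le_limn_einf u k) ul.
by exists n.
Qed.

Lemma limn_einf_le_cvg u v l : (forall n, u n <= v n) -> v @ \oo --> l ->
  limn_einf u <= l.
Proof.
move=> uv vl; rewrite limn_einf_lim -(cvg_lim _ vl)//.
apply: lee_lim; [exact: is_cvg_einfs|by apply/cvg_ex; exists l|].
apply: nearW => n; apply: le_trans (uv n).
by apply: ereal_inf_lbound; exists n => /=.
Qed.

Lemma cvg_ereal_sup_range s t :
  (forall k, \forall n \near \oo, s k <= t n) ->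
  (forall n, t n <= ereal_sup (range s)) ->
  t @ \oo --> ereal_sup (range s).
Proof.
move=> st ts; apply: (squeeze_cvge _ (f := einfs t)); last exact: cvg_cst.
  apply: nearW => n; rewrite ts andbT.
  by apply: ereal_inf_lbound; exists n => /=.
suff -> : ereal_sup (range s) = ereal_sup (range (einfs t)).
  exact: cvg_einfs_sup.
apply/le_anti/andP; split; apply: ge_ereal_sup => _ [k _ <-].
- have [N _ stN] := st k.
  apply: le_ereal_sup_tmp; exists (einfs t N); first by exists N.
  by apply: le_ereal_inf_tmp => _ [n /= Nn <-]; exact: stN.
- by apply: le_trans (ts k); apply: ereal_inf_lbound; exists k => /=.
Qed.

End ereal_sequences.

Lemma cvg_geometric_half_increments (R : realType) (u : R^nat) :
  (\forall n \near \oo, `|u n.+1 - u n| < 2^-1 ^+ n) -> cvgn u.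
Proof.
move=> [N _ uN]; pose v n := u (n + N)%N.
suff : cvgn v.
  by move=> /cvg_ex[l vl]; apply/cvg_ex; exists l; rewrite -(cvg_shiftn N).
have -> : v = (fun n => v 0%N + series (fun k => v k.+1 - v k) n).
  by apply/funext => n; rewrite /series/= telescope_sumr// subrKC.
apply: is_cvgD; first exact: is_cvg_cst.
apply: normed_cvg; apply: (@series_le_cvg _ _ (geometric 1 2^-1)).
- by move=> n /=; exact: normr_ge0.
- by move=> n; rewrite /geometric/= mul1r exprn_ge0.
- move=> n; rewrite /geometric/= /v mul1r; apply: ltW.
  apply: lt_le_trans (uN (n + N)%N (leq_addl _ _)) _.
  by rewrite addnC exprD ler_piMl ?exprn_ge0// exprn_ile1//; lra.
- by apply: is_cvg_geometric_series; rewrite ger0_norm//; lra.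
Qed.

Section ae_convergence.
Context {d : measure_display} {X : measurableType d} {R : realType}.
Variable mu : {measure set X -> \bar R}.

Lemma measurable_fun_limn_einf (f : (X -> \bar R)^nat) :
  (forall n, measurable_fun setT (f n)) ->
  measurable_fun setT (fun x => limn_einf (f ^~ x)).
Proof.
move=> mf; apply: (emeasurable_fun_cvg (fun n x => einfs (f ^~ x) n)).
  exact: measurable_fun_einfs.
by move=> x _; rewrite limn_einf_lim; exact: is_cvg_einfs.
Qed.

Lemma ae_cvg_integral_le (f : (X -> \bar R)^nat) (g : X -> \bar R)
    (C : \bar R) :
  (forall n, measurable_fun setT (f n)) -> measurable_fun setT g ->
  (forall n x, 0 <= f n x)%E -> (forall x, 0 <= g x)%E ->
  {ae mu, forall x, f ^~ x @ \oo --> g x} ->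
  (forall n, \int[mu]_x f n x <= C)%E -> (\int[mu]_x g x <= C)%E.
Proof.
move=> mf mg f0 g0 fg fC.
apply: (@le_trans _ _ (\int[mu]_x limn_einf (f ^~ x))%E).
  apply: ae_ge0_le_integral => //.
  - by move=> x _; exact: limn_einf_ge0.
  - exact: measurable_fun_limn_einf.
  - by apply: filterS fg => x /cvg_limn_einf_sup[-> _] _.
apply: le_trans (fatou _ _ _ _) _ => //.
exact: limn_einf_le_cvg fC (cvg_cst _).
Qed.

Lemma integral_bounded_limn_einf_lty (f : (X -> \bar R)^nat) (C : R) :
  (forall n, measurable_fun setT (f n)) -> (forall n x, 0 <= f n x)%E ->
  (forall n, \int[mu]_x f n x <= C%:E)%E ->
  {ae mu, forall x, limn_einf (f ^~ x) < +oo}%E.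
Proof.
move=> mf f0 fC.
have lf0 x : (0 <= limn_einf (f ^~ x))%E by exact: limn_einf_ge0.
have /(integrable_ae measurableT) :
    mu.-integrable setT (fun x => limn_einf (f ^~ x)).
  apply/integrableP; split; first exact: measurable_fun_limn_einf.
  under eq_integral do rewrite gee0_abs//.
  apply: le_lt_trans (fatou _ _ _ _) _ => //.
  apply: le_lt_trans (ltry C); exact: limn_einf_le_cvg fC (cvg_cst _).
by apply: filterS => x /(_ I); rewrite ge0_fin_numE.
Qed.

Lemma ae_cvg_measurable_limit (h : nat -> X -> R) :
  (forall n, measurable_fun setT (h n)) -> {ae mu, forall x, cvgn (h ^~ x)} ->
  exists2 f : X -> R,
    measurable_fun setT f & {ae mu, forall x, h ^~ x @ \oo --> f x}.
Proof.
move=> mh ch; exists (fun x => fine (limn_einf (fun n => (h n x)%:E))).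
  apply: measurableT_comp => //.
  apply: (measurable_fun_limn_einf (f := fun n => EFin \o h n)) => n.
  exact/measurable_EFinP.
apply: filterS ch => x /cvg_ex[/= l hl].
have /cvg_limn_einf_sup[-> _] // : (fun n => (h n x)%:E) @ \oo --> l%:E.
by apply/fine_cvgP; split; first exact: nearW.
Qed.

Lemma ae_bounded_measurable_ubound (h : nat -> X -> R) :
  (forall n, measurable_fun setT (h n)) ->
  {ae mu, forall x, exists M, forall n, h n x <= M} ->
  exists2 V : X -> R, measurable_fun setT V & {ae mu, forall x n, h n x <= V x}.
Proof.
move=> mh hM; pose s x := esups (fun n => (h n x)%:E) 0%N.
exists (fun x => fine (s x)).
  apply: measurableT_comp => //.
  apply: (measurable_fun_esups (f := fun n => EFin \o h n)) => n.
  exact/measurable_EFinP.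
apply: filterS hM => x [M hM] n.
have hs m : ((h m x)%:E <= s x)%E by apply: ereal_sup_ubound; exists m.
rewrite -lee_fin fineK// fin_numElt (lt_le_trans (ltNyr _) (hs 0%N))/=.
apply: le_lt_trans (ltry M).
by apply: ge_ereal_sup => _ [k _ <-]; rewrite lee_fin.
Qed.

Lemma ae_nondecreasing_seq (h : nat -> X -> R) :
  (forall n, {ae mu, forall x, h n x <= h n.+1 x}) ->
  {ae mu, forall x, nondecreasing_seq (h ^~ x)}.
Proof.
by move=> /ae_foralln; apply: filterS => x hx; exact/nondecreasing_seqP.
Qed.

Lemma borel_cantelli_ae (B : nat -> set X) :
  (forall n, measurable (B n)) -> (\sum_(n <oo) mu (B n) < +oo)%E ->
  {ae mu, forall x, \forall n \near \oo, ~ B n x}.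
Proof.
move=> mB muB; have nB : mu.-negligible (lim_sup_set B).
  exists (lim_sup_set B); split; last exact: subset_refl.
    by apply: bigcapT_measurable => k; exact: bigcup_measurable.
  exact: lim_sup_set_cvg0.
apply: negligibleS nB => x /= Bx k _; apply: contrapT => notBk; apply: Bx.
by exists k => // n /= kn Bnx; apply: notBk; exists n.
Qed.

Lemma ae_near_lt_geometric_half (F : (set X)^nat) (p : nat -> X -> R) :
  nondecreasing_seq F -> \bigcup_n F n = setT -> (forall n, measurable (F n)) ->
  (forall n, measurable_fun setT (p n)) ->
  (forall n, (mu (F n `&` [set x | 2^-1 ^+ n <= `|p n x|]%R) <=
     (2^-1 ^+ n)%:E)%E) ->
  {ae mu, forall x, \forall n \near \oo, `|p n x| < 2^-1 ^+ n}.
Proof.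
move=> ndF FT mF mp muB; pose B n := F n `&` [set x | 2^-1 ^+ n <= `|p n x|].
have mB n : measurable (B n).
  apply: measurableI => //; rewrite -[X in measurable X]setTI.
  by apply: measurable_fun_le => //; exact: measurableT_comp.
have sumB : (\sum_(n <oo) mu (B n) < +oo)%E.
  apply: (@le_lt_trans _ _ (\sum_(n <oo) (2 / (2 ^ (n + 1))%:R : R)%:E)%E).
    apply: lee_nneseries => // n _; apply: le_trans (muB n) _.
    rewrite lee_fin expnD expn1 natrM natrX invfM mulrCA mulfV// mulr1.
    by rewrite exprVn.
  by have /cvg_lim -> := @cvg_geometric_eseries_half R 2 0; rewrite ?ltry.
apply: filterS (borel_cantelli_ae mB sumB) => x notB.
have [K _ FKx] : (\bigcup_n F n) x by rewrite FT.
near=> n; rewrite ltNge; apply/negP => pn.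
have : ~ B n x by near: n.
apply; split => //; have Kn : (K <= n)%N by near: n; exact: nbhs_infty_ge.
by have /subsetPset := ndF _ _ Kn; exact.
Unshelve. all: by end_near. Qed.

End ae_convergence.

(** * Square-integrable functions *)

Lemma sqr_ler_norm (R : realDomainType) (x y : R) :
  (x ^+ 2 <= y ^+ 2) = (`|x| <= `|y|).
Proof. by rewrite -[RHS]ler_sqr ?nnegrE// !real_normK ?num_real. Qed.

Section L2_space.
Context {d : measure_display} {X : measurableType d} {R : realType}.
Variable mu : {measure set X -> \bar R}.
Implicit Types f g : X -> R.

Lemma L2_Lfun f : L2 mu f <-> f \in Lfun mu 2%:E.
Proof.
have sqrE x : `|f x| `^ 2 = f x ^+ 2.
  by rewrite powR_mulrn// real_normK ?num_real.
split=> [[mf fi]|fL].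
  rewrite inE; apply/andP; split; rewrite inE//=.
  rewrite /finite_norm unlock poweR_lty//.
  by under eq_integral do rewrite /= sqrE.
split; first by move: fL; rewrite inE => /andP[/[!inE]].
have /integrableP[_] := Lfun2_integrable_sqr fL.
by under eq_integral do rewrite /= ger0_norm ?sqr_ge0//.
Qed.

Lemma L2_measurable f : L2 mu f -> measurable_fun setT f.
Proof. by case. Qed.

Lemma L2_le f g : measurable_fun setT g -> L2 mu f ->
  (forall x, `|g x| <= `|f x|) -> L2 mu g.
Proof.
move=> mg [mf fi] gf; split => //; apply: le_lt_trans fi.
apply: ge0_le_integral => //.
- by move=> x _; rewrite lee_fin sqr_ge0.
- exact/measurable_EFinP/measurable_funX.
- exact/measurable_EFinP/measurable_funX.
- by move=> x _; rewrite lee_fin sqr_ler_norm.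
Qed.

Lemma L2_0 : L2 mu (fun=> 0).
Proof. by apply/L2_Lfun; have [] := Lfun_submod_closed mu (lee1n 2). Qed.

Lemma L2_lin a f g : L2 mu f -> L2 mu g -> L2 mu (fun x => a * f x + g x).
Proof.
move=> /L2_Lfun Lf /L2_Lfun Lg.
by apply/L2_Lfun; have [_] := Lfun_submod_closed mu (lee1n 2); exact.
Qed.

Lemma L2_scale a f : L2 mu f -> L2 mu (a \*o f).
Proof.
by move=> /(L2_lin a)/(_ L2_0); congr L2; apply/funext => x; rewrite addr0.
Qed.

Lemma L2_add f g : L2 mu f -> L2 mu g -> L2 mu (f \+ g).
Proof.
by move=> /(L2_lin 1) Lf /Lf; congr L2; apply/funext => x; rewrite mul1r.
Qed.

Lemma L2_sub f g : L2 mu f -> L2 mu g -> L2 mu (f \- g).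
Proof.
move=> Lf /(L2_lin (-1))/(_ Lf); congr L2.
by apply/funext => x /=; rewrite mulN1r addrC.
Qed.

Lemma L2_abs f : L2 mu f -> L2 mu (fun x => `|f x|).
Proof.
move=> Lf; apply: (L2_le _ Lf) => [|x]; last by rewrite normr_id.
by apply: measurableT_comp => //; exact: L2_measurable.
Qed.

Lemma L2_funrpos f : L2 mu f -> L2 mu f^\+.
Proof.
move=> Lf; apply: (L2_le _ Lf) => [|x].
  exact/measurable_funrpos/L2_measurable.
by rewrite ger0_norm ?funrpos_ge0// /funrpos ge_max normr_ge0 ler_norm.
Qed.

Lemma L2_integrable_mul f g : L2 mu f -> L2 mu g ->
  mu.-integrable setT (EFin \o (f \* g)).
Proof.
by move=> /L2_Lfun Lf /L2_Lfun Lg; exact/Lfun1_integrable/Lfun2_mul_Lfun1.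
Qed.

End L2_space.

Section L2_inner_product.
Context {d : measure_display} {X : measurableType d} {R : realType}.
Variable mu : {measure set X -> \bar R}.
Implicit Types f g h p : X -> R.

Definition dotL2 f g : R := \int[mu]_x (f x * g x).
Local Notation dot := dotL2.

Lemma dotL2E f g : L2 mu f -> L2 mu g ->
  (\int[mu]_x (f x * g x)%:E)%E = (dot f g)%:E.
Proof.
move=> Lf Lg; rewrite /dotL2 /Rintegral fineK//.
exact: integrable_fin_num (L2_integrable_mul Lf Lg).
Qed.

Lemma dotL2C f g : dot f g = dot g f.
Proof. by apply: eq_Rintegral => x _; rewrite mulrC. Qed.

Lemma dotL2Dl f g h : L2 mu f -> L2 mu g -> L2 mu h ->
  dot (f \+ g) h = dot f h + dot g h.
Proof.
move=> Lf Lg Lh; rewrite /dotL2 -RintegralD//; try exact: L2_integrable_mul.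
by apply: eq_Rintegral => x _; rewrite mulrDl.
Qed.

Lemma dotL2Zl a f h : L2 mu f -> L2 mu h -> dot (a \*o f) h = a * dot f h.
Proof.
move=> Lf Lh; rewrite /dotL2 -RintegralZl//; last exact: L2_integrable_mul.
by apply: eq_Rintegral => x _; rewrite mulrA.
Qed.

Lemma dotL2Bl f g h : L2 mu f -> L2 mu g -> L2 mu h ->
  dot (f \- g) h = dot f h - dot g h.
Proof.
move=> Lf Lg Lh; rewrite /dotL2 -RintegralB//; try exact: L2_integrable_mul.
by apply: eq_Rintegral => x _; rewrite mulrBl.
Qed.

Lemma dotL2Dr f g h : L2 mu f -> L2 mu g -> L2 mu h ->
  dot h (f \+ g) = dot h f + dot h g.
Proof. by move=> *; rewrite dotL2C dotL2Dl// !(dotL2C h). Qed.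

Lemma dotL2Zr a f h : L2 mu f -> L2 mu h -> dot h (a \*o f) = a * dot h f.
Proof. by move=> *; rewrite dotL2C dotL2Zl// (dotL2C h). Qed.

Lemma dotL2Br f g h : L2 mu f -> L2 mu g -> L2 mu h ->
  dot h (f \- g) = dot h f - dot h g.
Proof. by move=> *; rewrite dotL2C dotL2Bl// !(dotL2C h). Qed.

Lemma dotL2_ge0 f g : measurable_fun setT f -> measurable_fun setT g ->
  {ae mu, forall x, 0 <= f x * g x} -> 0 <= dot f g.
Proof.
move=> mf mg fg0; have mfg := measurable_funM mf mg.
suff -> : dot f g = \int[mu]_x `|f x * g x| by exact: Rintegral_ge0.
congr fine; apply: ae_eq_integral => //.
- exact/measurable_EFinP.
- by apply/measurable_EFinP; exact: measurableT_comp.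
- by apply: filterS fg0 => x fgx _ /=; rewrite ger0_norm.
Qed.

Lemma dotL2_le_integral f g p : L2 mu f -> L2 mu g -> measurable_fun setT p ->
  (forall x, 0 <= p x) -> {ae mu, forall x, `|f x * g x| <= p x} ->
  ((dot f g)%:E <= \int[mu]_x (p x)%:E)%E.
Proof.
move=> Lf Lg mp p0 fgp; rewrite -dotL2E//.
have mfg : measurable_fun setT (EFin \o (f \* g)).
  apply/measurable_EFinP/measurable_funM.
    exact: L2_measurable Lf.
  exact: L2_measurable Lg.
apply: le_trans (lee_abs _) _; apply: le_trans (le_abse_integral _ _ _) _ => //.
apply: ae_ge0_le_integral => //.
- exact: measurableT_comp.
- by move=> x _; rewrite lee_fin.
- exact/measurable_EFinP.
- by apply: filterS fgp => x fgx _; rewrite lee_fin.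
Qed.

Definition normL2 f : R := fine ('N[mu]_2%:E[EFin \o f])%E.
Local Notation norm := normL2.

Lemma normL2E f : L2 mu f -> ('N[mu]_2%:E[EFin \o f])%E = (norm f)%:E.
Proof.
move=> /L2_Lfun; rewrite inE => /andP[_ /[!inE] Nf].
by rewrite /normL2 fineK// ge0_fin_numE ?Lnorm_ge0.
Qed.

Lemma normL2_ge0 f : 0 <= norm f.
Proof. by rewrite fine_ge0 ?Lnorm_ge0. Qed.

Lemma normL2_eq0 f : L2 mu f -> norm f = 0 -> {ae mu, forall x, f x = 0}.
Proof.
move=> Lf f0; have mf := L2_measurable Lf.
have /Lnorm_eq0_eq0 : ('N[mu]_2%:E[EFin \o f])%E = 0%E by rewrite normL2E// f0.
rewrite lte_fin ltr0n => /(_ _ isT); have /measurable_EFinP mfE := mf.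
by move=> /(_ mfE); apply: filterS => x /(_ I)[].
Qed.

Lemma sqr_normL2 f : L2 mu f -> (\int[mu]_x (f x ^+ 2)%:E)%E = (norm f ^+ 2)%:E.
Proof.
move=> Lf; rewrite -powR_mulrn ?normL2_ge0// -poweR_EFin -normL2E//.
rewrite powR_Lnorm//.
by apply: eq_integral => x _ /=; rewrite powR_mulrn// real_normK ?num_real.
Qed.

Lemma dotL2ff f : L2 mu f -> dot f f = norm f ^+ 2.
Proof. by move=> Lf; apply: EFin_inj; rewrite -sqr_normL2// -dotL2E. Qed.

Lemma sqr_normL2B f g : L2 mu f -> L2 mu g ->
  norm (f \- g) ^+ 2 = norm f ^+ 2 - 2 * dot f g + norm g ^+ 2.
Proof.
move=> Lf Lg; have Lfg := L2_sub Lf Lg.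
by rewrite -!dotL2ff// dotL2Bl// !dotL2Br// (dotL2C g f); ring.
Qed.

Lemma sqr_normL2_convex t f g : L2 mu f -> L2 mu g ->
  norm (t \*o f \+ (1 - t) \*o g) ^+ 2 =
  t * norm f ^+ 2 + (1 - t) * norm g ^+ 2 - t * (1 - t) * norm (f \- g) ^+ 2.
Proof.
move=> Lf Lg; have Ltf := L2_scale t Lf; have Lsg := L2_scale (1 - t) Lg.
have Lfg := L2_add Ltf Lsg.
rewrite sqr_normL2B// -(dotL2ff Lfg) !dotL2Dl// !dotL2Dr//.
by rewrite !dotL2Zl// !dotL2Zr// !dotL2ff// (dotL2C g f); ring.
Qed.

Lemma CauchySchwarz_L2 f g : L2 mu f -> L2 mu g ->
  `|dot f g| <= norm f * norm g.
Proof.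
move=> Lf Lg; rewrite -lee_fin EFin_normr_Rintegral//; last first.
  exact: L2_integrable_mul.
have mf := L2_measurable Lf; have mg := L2_measurable Lg.
apply: le_trans (le_abse_integral _ _ _) _ => //.
  exact/measurable_EFinP/measurable_funM.
rewrite EFinM -!normL2E// -(Lnorm1 mu (EFin \o (f \* g))).
by apply: hoelder => //; lra.
Qed.

Lemma dist2E f g : L2 mu f -> L2 mu g ->
  dist2 mu f g = (norm (f \- g) ^+ 2)%:E.
Proof. by move=> Lf Lg; rewrite -sqr_normL2//; exact: L2_sub. Qed.

End L2_inner_product.

Section L2_convergence.
Context {d : measure_display} {X : measurableType d} {R : realType}.
Variable mu : {measure set X -> \bar R}.
Implicit Types (f g l u : X -> R) (h : nat -> X -> R).
Local Notation dot := (dotL2 mu).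
Local Notation norm := (normL2 mu).

Lemma dotL2_cvg f h u : L2 mu f -> (forall n, L2 mu (h n)) -> L2 mu u ->
  norm (h n \- u) @[n --> \oo] --> 0 -> dot f (h n) @[n --> \oo] --> dot f u.
Proof.
move=> Lf Lh Lu hu; apply/subr_cvg0; apply: norm_cvg0.
apply: (@squeeze_cvgr _ _ _ _ (cst 0) (fun n => norm f * norm (h n \- u))).
- apply: nearW => n; rewrite normr_ge0/= -dotL2Br//.
  by apply: CauchySchwarz_L2 => //; exact: L2_sub.
- exact: cvg_cst.
- by rewrite -[X in _ --> X](mulr0 (norm f)); apply: cvgM => //; exact: cvg_cst.
Qed.

Lemma sqr_normL2_cvg h u : (forall n, L2 mu (h n)) -> L2 mu u ->
  norm (h n \- u) @[n --> \oo] --> 0 ->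
  norm (h n) ^+ 2 @[n --> \oo] --> norm u ^+ 2.
Proof.
move=> Lh Lu hu; have -> : (fun n => norm (h n) ^+ 2) =
    (fun n => norm (h n \- u) ^+ 2 + 2 * dot u (h n) - norm u ^+ 2).
  by apply/funext => n; rewrite sqr_normL2B// (dotL2C mu u); ring.
rewrite [X in _ --> X](_ : _ = 0 ^+ 2 + 2 * dot u u - norm u ^+ 2); last first.
  by rewrite dotL2ff//; ring.
apply: cvgB; last exact: cvg_cst.
apply: cvgD; last by apply: cvgM; [exact: cvg_cst|exact: dotL2_cvg].
exact: (cvgM hu hu).
Qed.

Lemma chebyshev_L2 f (e : R) : 0 < e -> L2 mu f ->
  (mu [set x | e <= `|f x|]%R * (e ^+ 2)%:E <= (norm f ^+ 2)%:E)%E.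
Proof.
move=> e0 Lf; have mf2 : measurable_fun setT (EFin \o (fun x => f x ^+ 2)).
  by apply/measurable_EFinP/measurable_funX; exact: L2_measurable Lf.
have sqr_e_gt0 : 0 < e ^+ 2 by rewrite exprn_gt0.
have -> : [set x | e <= `|f x|] =
    setT `&` [set x | ((e ^+ 2)%:E <= `|(EFin \o (fun x => f x ^+ 2)%R) x|)%E].
  rewrite setTI; apply/seteqP; split => x /=;
    by rewrite lee_fin normrX ler_pXn2r ?nnegrE// ltW.
rewrite muleC.
apply: le_trans (le_integral_abse mu measurableT mf2 sqr_e_gt0) _.
by rewrite -sqr_normL2//; under eq_integral do rewrite /= ger0_norm ?sqr_ge0//.
Qed.

Lemma L2_fatou h f (C : R) : (forall n, L2 mu (h n)) -> measurable_fun setT f ->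
  {ae mu, forall x, h ^~ x @ \oo --> f x} -> (forall n, norm (h n) <= C) ->
  L2 mu f /\ norm f <= C.
Proof.
move=> Lh mf hf hC.
have C0 : 0 <= C by exact: le_trans (normL2_ge0 _ _) (hC 0%N).
have fC : (\int[mu]_x (f x ^+ 2)%:E <= (C ^+ 2)%:E)%E.
  apply: (ae_cvg_integral_le (f := fun n x => (h n x ^+ 2)%:E)).
  - move=> n; apply/measurable_EFinP/measurable_funX.
    exact: L2_measurable (Lh n).
  - exact/measurable_EFinP/measurable_funX.
  - by move=> n x; rewrite lee_fin sqr_ge0.
  - by move=> x; rewrite lee_fin sqr_ge0.
  - apply: filterS hf => x hx; apply: cvg_EFin; first exact: nearW.
    exact: (cvgM hx hx).
  - by move=> n; rewrite sqr_normL2// lee_fin lerXn2r ?nnegrE ?normL2_ge0.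
have Lf : L2 mu f by split => //; exact: le_lt_trans fC (ltry _).
split => //.
by move: fC; rewrite sqr_normL2// lee_fin ler_sqr ?nnegrE ?normL2_ge0.
Qed.

Lemma L2_dominated_cvg h f g : (forall n, L2 mu (h n)) -> L2 mu f -> L2 mu g ->
  (forall x, h ^~ x @ \oo --> f x) -> (forall n x, `|h n x - f x| <= g x) ->
  norm (h n \- f) @[n --> \oo] --> 0.
Proof.
move=> Lh Lf Lg hf hg; have Lhf n : L2 mu (h n \- f) by exact: L2_sub.
have mhf n := L2_measurable (Lhf n).
have /fine_cvgP[_ hf0] :
    (\int[mu]_x ((h n x - f x) ^+ 2)%:E)%E @[n --> \oo] --> 0%E.
  have [|||||_ _] := @dominated_convergence _ _ _ mu setT measurableT
    (fun n x => ((h n x - f x) ^+ 2)%:E) (cst 0%E)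
    (EFin \o (fun x => g x ^+ 2)).
  - by move=> n; apply/measurable_EFinP/measurable_funX; exact: mhf.
  - exact: measurable_cst.
  - apply: aeW => x _; apply: cvg_EFin; first exact: nearW.
    have hfx : h n x - f x @[n --> \oo] --> 0 by apply/subr_cvg0.
    by rewrite -[X in _ --> X](mulr0 0); exact: (cvgM hfx hfx).
  - exact/Lfun2_integrable_sqr/L2_Lfun.
  - apply: aeW => x n _; rewrite lee_fin ger0_norm ?sqr_ge0//.
    by rewrite sqr_ler_norm; apply: le_trans (hg n x) (ler_norm _).
  by rewrite integral_cst// mul0e.
apply/cvgr0Pnorm_lt => e e0.
have /cvgr0Pnorm_lt/(_ (e ^+ 2)) := hf0; rewrite exprn_gt0// => /(_ isT).
apply: filterS => n /=; rewrite (sqr_normL2 (Lhf n))/= normrX.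
by rewrite ltr_pXn2r ?nnegrE// ltW.
Qed.

Lemma L2_fast_cauchy_ae_cvg h : (forall n, L2 mu (h n)) ->
  (forall n, norm (h n.+1 \- h n) <= 4^-1 ^+ n) ->
  {ae mu, forall x, cvgn (h ^~ x)}.
Proof.
move=> Lh hC; have Ldh n : L2 mu (h n.+1 \- h n) by exact: L2_sub.
suff : {ae mu, forall x, \forall n \near \oo, `|h n.+1 x - h n x| < 2^-1 ^+ n}.
  by apply: filterS => x; exact: cvg_geometric_half_increments.
apply: (@ae_near_lt_geometric_half _ _ _ mu (fun=> setT)) => //.
- exact: bigcup_const.
- by move=> n; exact: (L2_measurable (Ldh n)).
move=> n; rewrite setTI.
have half_n_gt0 : 0 < (2^-1 : R) ^+ n by rewrite exprn_gt0.
have := chebyshev_L2 half_n_gt0 (Ldh n).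
rewrite -lee_pdivlMr ?exprn_gt0// => /le_trans; apply.
rewrite lee_fin ler_pdivrMr ?exprn_gt0// -exprS.
apply: (@le_trans _ _ ((4^-1 ^+ n) ^+ 2)).
  by rewrite lerXn2r ?nnegrE ?normL2_ge0.
rewrite (_ : 4^-1 = 2^-1 ^+ 2 :> R); last by field.
by rewrite -!exprM mulnCA ler_wiXn2l ?leq_mul//; lra.
Qed.

Lemma L2_complete h : (forall n, L2 mu (h n)) ->
  (forall e : R, 0 < e -> exists N, forall n m,
     (N <= n)%N -> (N <= m)%N -> norm (h n \- h m) <= e) ->
  exists2 u, L2 mu u & norm (h n \- u) @[n --> \oo] --> 0.
Proof.
move=> Lh hC; have mh n := L2_measurable (Lh n).
have quarter_gt0 k : 0 < (4^-1 : R) ^+ k by rewrite exprn_gt0.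
have /choice[N hN] := fun k => hC _ (quarter_gt0 k).
pose s k := (\sum_(i < k.+1) N i)%N.
have Ns k j : (k <= j)%N -> (N k <= s j)%N.
  by move=> kj; rewrite /s (bigD1 (inord k))//= inordK ?ltnS// leq_addr.
have [u mfu hu] : exists2 u : X -> R, measurable_fun setT u &
    {ae mu, forall x, (fun k => h (s k) x) @ \oo --> u x}.
  apply: ae_cvg_measurable_limit => //.
  apply: L2_fast_cauchy_ae_cvg => // k.
  by apply: hN; apply: Ns.
have hu_le k n : (N k <= n)%N ->
    L2 mu (h n \- u) /\ norm (h n \- u) <= 4^-1 ^+ k.
  move=> Nkn; apply: (L2_fatou (h := fun j => h n \- h (s (j + k)%N))).
  - by move=> j; exact: L2_sub.
  - exact: measurable_funB.
  - apply: filterS hu => x hux; apply: cvgB; first exact: cvg_cst.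
    by rewrite (cvg_shiftn k (fun j => h (s j) x)).
  - by move=> j; apply: hN => //; apply: Ns; exact: leq_addl.
have Lu : L2 mu u.
  have [Lhu _] := hu_le 0%N (N 0%N) (leqnn _).
  have := L2_sub (Lh (N 0%N)) Lhu; congr L2.
  by apply/funext => x /=; rewrite subKr.
exists u => //; apply/cvgr0Pnorm_lt => e e0.
have [k _ /(_ k (leqnn k)) ke] : \forall k \near \oo, (4^-1 : R) ^+ k < e.
  have /cvgr0Pnorm_lt/(_ e e0) : (4^-1 : R) ^+ n @[n --> \oo] --> 0.
    by apply: cvg_expr; rewrite ger0_norm//; lra.
  by apply: filterS => k; exact/le_lt_trans/ler_norm.
exists (N k) => // n /= Nkn; rewrite ger0_norm ?normL2_ge0//.
exact: le_lt_trans (hu_le k n Nkn).2 ke.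
Qed.

Lemma L2_cvg_ae_cvg_unique h u l :
  (forall n, L2 mu (h n)) -> L2 mu u -> measurable_fun setT l ->
  norm (h n \- u) @[n --> \oo] --> 0 ->
  {ae mu, forall x, h ^~ x @ \oo --> l x} ->
  {ae mu, forall x, l x = u x}.
Proof.
move=> Lh Lu ml hu hl.
have lu_le e : 0 < e -> L2 mu (l \- u) /\ norm (l \- u) <= e.
  move=> e0; have /cvgr0Pnorm_lt/(_ e e0)[N _ hN] := hu.
  apply: (L2_fatou (h := fun n => h (n + N)%N \- u)).
  - by move=> n; exact: L2_sub.
  - by apply: measurable_funB => //; exact: L2_measurable Lu.
  - apply: filterS hl => x hlx; apply: cvgB; last exact: cvg_cst.
    by rewrite (cvg_shiftn N (h ^~ x)).
  - move=> n; apply: le_trans (ler_norm _) _; apply/ltW/hN; exact: leq_addl.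
have [Llu _] := lu_le 1 ltr01.
apply: filterS (normL2_eq0 Llu _); first by move=> x /subr0_eq.
apply/le_anti; rewrite normL2_ge0 andbT; apply/ler_addgt0Pr => e e0.
by rewrite add0r; case: (lu_le e e0).
Qed.

Lemma ae_nondecreasing_L2_cvg h u : (forall n, L2 mu (h n)) -> L2 mu u ->
  (forall n, {ae mu, forall x, h n x <= h n.+1 x}) ->
  (forall n, {ae mu, forall x, h n x <= u x}) ->
  norm (h n \- u) @[n --> \oo] --> 0 -> {ae mu, forall x, h ^~ x @ \oo --> u x}.
Proof.
move=> Lh Lu /ae_nondecreasing_seq nd /ae_foralln hu hu0.
have cvgh : {ae mu, forall x, cvgn (h ^~ x)}.
  apply: filterS2 nd hu => x ndx hux.
  by apply: nondecreasing_is_cvgn => //; exists (u x) => _ [n _ <-].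
have [l ml hl] := ae_cvg_measurable_limit (fun n => L2_measurable (Lh n)) cvgh.
by apply: filterS2 hl (L2_cvg_ae_cvg_unique Lh Lu ml hu0 hl) => x hlx <-.
Qed.

End L2_convergence.

(** * Subgradients and resolvents *)

Lemma harmonic_perturbation_ge0 (R : realType) (A B : R) :
  (forall n, 0 <= A + harmonic n * B) -> 0 <= A.
Proof.
move=> AB; have : A + harmonic n * B @[n --> \oo] --> A + 0 * B.
  apply: cvgD; first exact: cvg_cst.
  by apply: cvgM; [exact: cvg_harmonic|exact: cvg_cst].
rewrite mul0r addr0 => /cvgr_to_ge; apply; exact: nearW.
Qed.

Section subgradient.
Context {d : measure_display} {X : measurableType d} {R : realType}.
Variables (mu : {measure set X -> \bar R}) (E : (X -> R) -> \bar R).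
Hypothesis nopfE : nonlinear_order_preserving_form mu E.
Implicit Types (f g h u v p : X -> R) (t : R).
Local Notation dot := (dotL2 mu).
Local Notation norm := (normL2 mu).

Lemma form_fineK f : L2 mu f -> (E f < +oo)%E -> (fine (E f))%:E = E f.
Proof.
by move=> Lf Ef; rewrite fineK// ge0_fin_numE//; exact: (nopf_ge0 nopfE).
Qed.

Lemma form_scale f t : L2 mu f -> 0 <= t <= 1 -> (E (t \*o f) <= t%:E * E f)%E.
Proof.
move=> Lf t01; have := nopf_convex nopfE Lf (L2_0 mu) t01.
rewrite (nopf_0 nopfE) mule0 adde0.
by congr (E _ <= _)%E; apply/funext => x; rewrite mulr0 addr0.
Qed.

Lemma form_abs f : L2 mu f -> (E (fun x => `|f x|)%R <= E f)%E.
Proof.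
move=> Lf; have [Ef|] := ltP (E f) +oo%E; last first.
  by rewrite leye_eq => /eqP ->; rewrite leey.
have absf0 := nopf_ge0 nopfE (L2_abs Lf).
have := nopf_order nopfE (L2_0 mu) Lf.
under [X in (E X + _ <= _)%E]eq_fun do rewrite add0r.
under [X in (_ + E X <= _)%E]eq_fun do rewrite sub0r.
under [X in (_ <= E X + _)%E]eq_fun do rewrite add0r.
under [X in (_ <= _ + E X)%E]eq_fun do rewrite sub0r.
rewrite !(nopf_sym nopfE)//; last exact: L2_abs.
rewrite -(form_fineK Lf Ef); move: absf0.
by case: (E (fun x => `|f x|)) => [r| |]//=; rewrite -?EFinD ?lee_fin; lra.
Qed.

Lemma form_min_max u v : L2 mu u -> L2 mu v ->
  (E (u \min v) + E (u \max v) <= E u + E v)%E.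
Proof.
move=> Lu Lv; pose f := 2^-1 \*o (u \+ v); pose g := 2^-1 \*o (u \- v).
have Lf : L2 mu f by apply/L2_scale/L2_add.
have Lg : L2 mu g by apply/L2_scale/L2_sub.
have := nopf_order nopfE Lf Lg; rewrite addeC; congr (E _ + E _ <= E _ + E _)%E;
  apply/funext => x /=; rewrite /f /g/=.
- by rewrite minr_absE normrM ger0_norm//; field.
- by rewrite maxr_absE normrM ger0_norm//; field.
- by field.
- by field.
Qed.

Definition is_subgradient u p :=
  [/\ L2 mu u, L2 mu p, (E u < +oo)%E &
      forall h, L2 mu h -> (E u + (dot p (h \- u))%:E <= E h)%E].

Lemma is_subgradient0 : is_subgradient (fun=> 0) (fun=> 0).
Proof.
have L0 := L2_0 mu; split => // [|h Lh]; first by rewrite (nopf_0 nopfE).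
rewrite (nopf_0 nopfE) add0e (_ : dot _ _ = 0) ?(nopf_ge0 nopfE)//.
rewrite [LHS](_ : _ = dot (0 \*o h) h); first by rewrite dotL2Zl// mul0r.
by apply: eq_Rintegral => x _; rewrite /= !mul0r.
Qed.

Lemma subgradient_form_le u p : is_subgradient u p -> (E u <= (dot p u)%:E)%E.
Proof.
move=> [Lu Lp Eu /(_ _ (L2_0 mu))].
have -> : (fun=> 0) \- u = -1 \*o u by apply/funext => x /=; ring.
by rewrite (nopf_0 nopfE) -(form_fineK Lu Eu) dotL2Zr// -EFinD !lee_fin; lra.
Qed.

Lemma subgradient_monotone u1 u2 p1 p2 :
  is_subgradient u1 p1 -> is_subgradient u2 p2 ->
  0 <= dot (p1 \- p2) (u1 \- u2).
Proof.
move=> [Lu1 Lp1 Eu1 sub1] [Lu2 Lp2 Eu2 sub2].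
have := sub1 _ Lu2; have := sub2 _ Lu1.
rewrite -(form_fineK Lu1 Eu1) -(form_fineK Lu2 Eu2) -!EFinD !lee_fin.
by rewrite dotL2Bl ?dotL2Br//; [lra|exact: L2_sub].
Qed.

Lemma subgradient_T_monotone u1 u2 p1 p2 :
  is_subgradient u1 p1 -> is_subgradient u2 p2 ->
  0 <= dot (p1 \- p2) (u1 \- u2)^\+.
Proof.
move=> [Lu1 Lp1 Eu1 sub1] [Lu2 Lp2 Eu2 sub2]; set q := (u1 \- u2)^\+.
have Lq : L2 mu q by apply: L2_funrpos; exact: L2_sub.
have minE : u1 \min u2 = u1 \- q.
  apply/funext => x; rewrite /q /funrpos/=.
  by have [] := leP (u1 x) (u2 x); have [] := leP (u1 x - u2 x) 0; lra.
have maxE : u1 \max u2 = u2 \+ q.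
  apply/funext => x; rewrite /q /funrpos/=.
  by have [] := leP (u1 x) (u2 x); have [] := leP (u1 x - u2 x) 0; lra.
have Lmin : L2 mu (u1 \- q) by exact: L2_sub.
have Lmax : L2 mu (u2 \+ q) by exact: L2_add.
have := form_min_max Lu1 Lu2; rewrite minE maxE.
have := sub1 _ Lmin; have := sub2 _ Lmax.
have -> : (u2 \+ q) \- u2 = q by apply/funext => x /=; ring.
have -> : (u1 \- q) \- u1 = -1 \*o q by apply/funext => x /=; ring.
rewrite dotL2Zr// dotL2Bl// -(form_fineK Lu1 Eu1) -(form_fineK Lu2 Eu2).
move: (nopf_ge0 nopfE Lmin) (nopf_ge0 nopfE Lmax).
case: (E (u1 \- q)) => [r1| |]// _; case: (E (u2 \+ q)) => [r2| |]// _;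
  rewrite -?EFinD ?lee_fin//; lra.
Qed.

End subgradient.

Section resolvent.
Context {d : measure_display} {X : measurableType d} {R : realType}.
Variables (mu : {measure set X -> \bar R}) (E : (X -> R) -> \bar R).
Hypothesis nopfE : nonlinear_order_preserving_form mu E.
Implicit Types (f h u : X -> R) (a b t : R).
Local Notation dot := (dotL2 mu).
Local Notation norm := (normL2 mu).
Local Notation is_subgradient := (is_subgradient mu E).

Definition proximal a f h : \bar R :=
  (E h + (a / 2)%R%:E * dist2 mu h (fun x => a^-1 * f x)%R)%E.

Definition proximal_quad a f h : R :=
  a / 2 * norm h ^+ 2 - dot f h + (2 * a)^-1 * norm f ^+ 2.

Lemma proximalE a f h : 0 < a -> L2 mu f -> L2 mu h ->
  proximal a f h = (E h + (proximal_quad a f h)%:E)%E.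
Proof.
move=> a0 Lf Lh; have Laf := L2_scale a^-1 Lf.
rewrite /proximal dist2E// -EFinM; congr (_ + _%:E)%E.
rewrite sqr_normL2B// -(dotL2ff Laf) !dotL2Zl ?dotL2Zr// dotL2ff//.
by rewrite /proximal_quad (dotL2C mu f); field; rewrite gt_eqF.
Qed.

Lemma proximal_quad_expansion a f h u : L2 mu f -> L2 mu h -> L2 mu u ->
  proximal_quad a f h = proximal_quad a f u
    - dot (f \- a \*o u) (h \- u) + a / 2 * norm (h \- u) ^+ 2.
Proof.
move=> Lf Lh Lu; have Lau := L2_scale a Lu; have Lfu := L2_sub Lf Lau.
rewrite /proximal_quad sqr_normL2B// dotL2Br// !dotL2Bl// !dotL2Zl// dotL2ff//.
by rewrite (dotL2C mu h u); lra.
Qed.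

Lemma proximal_strongly_convex a f h u t :
  0 < a -> L2 mu f -> L2 mu h -> L2 mu u -> 0 <= t <= 1 ->
  (proximal a f (t \*o h \+ (1 - t) \*o u)%R +
     (a / 2 * (t * (1 - t)) * norm (h \- u) ^+ 2)%:E <=
   t%:E * proximal a f h + (1 - t)%:E * proximal a f u)%E.
Proof.
move=> a0 Lf Lh Lu t01; have Lth := L2_scale t Lh.
have Lsu := L2_scale (1 - t) Lu; have Lv := L2_add Lth Lsu.
rewrite !proximalE// !muleDr ?fin_num_adde_defl// addeACA -!EFinM -!EFinD.
rewrite -[leLHS]addeA -EFinD; apply: leeD; first exact: (nopf_convex nopfE).
rewrite lee_fin /proximal_quad sqr_normL2_convex// dotL2Dr// !dotL2Zr//.
lra.
Qed.

Lemma proximal_lty_form_lty a f h : 0 < a -> L2 mu f -> L2 mu h ->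
  (proximal a f h < +oo)%E -> (E h < +oo)%E.
Proof.
move=> a0 Lf Lh; rewrite proximalE//.
by case: (E h) (nopf_ge0 nopfE Lh) => // r _ _; exact: ltry.
Qed.

Lemma is_resolvent_form_lty a f u : 0 < a -> L2 mu f ->
  is_resolvent mu E a f u -> (E u < +oo)%E.
Proof.
move=> a0 Lf [Lu /(_ _ (L2_0 mu)) umin].
apply: (proximal_lty_form_lty a0 Lf Lu); apply: le_lt_trans umin _.
rewrite -/(proximal a f _) proximalE//; last exact: L2_0.
by rewrite (nopf_0 nopfE) add0e ltry.
Qed.

Lemma is_resolvent_quadratic_growth a f u h :
  0 < a -> L2 mu f -> L2 mu h -> is_resolvent mu E a f u ->
  (proximal a f u + (a / 2 * norm (h \- u) ^+ 2)%:E <= proximal a f h)%E.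
Proof.
move=> a0 Lf Lh Ru; have Eu := is_resolvent_form_lty a0 Lf Ru.
have [Lu umin] := Ru; have [Eh|] := ltP (E h) +oo%E; last first.
  by rewrite leye_eq [leRHS]proximalE// => /eqP ->; rewrite addye// leey.
have JuE : exists r, proximal a f u = r%:E.
  by rewrite proximalE// -(form_fineK nopfE Lu Eu) -EFinD; eexists.
have JhE : exists r, proximal a f h = r%:E.
  by rewrite proximalE// -(form_fineK nopfE Lh Eh) -EFinD; eexists.
have [ru Ju] := JuE; have [rh Jh] := JhE.
rewrite Ju Jh -EFinD lee_fin -subr_ge0.
apply: (@harmonic_perturbation_ge0 _ _ (a / 2 * norm (h \- u) ^+ 2)) => n.
have t0 : 0 < harmonic n :> R := harmonic_gt0 n.
have t1 : harmonic n <= 1 :> R by rewrite /= invf_le1// ler1n.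
move: (harmonic n) t0 t1 => t t0 t1; have t01 : 0 <= t <= 1 by rewrite ltW.
have Lv : L2 mu (t \*o h \+ (1 - t) \*o u) by apply: L2_add; exact: L2_scale.
have := le_trans (leeD2r _ (umin _ Lv))
  (proximal_strongly_convex a0 Lf Lh Lu t01).
rewrite -/(proximal a f u) Ju Jh -!EFinM -!EFinD lee_fin => convex_min.
by rewrite -(pmulr_rge0 _ t0); lra.
Qed.

Lemma is_resolvent_subgradient a f u : 0 < a -> L2 mu f ->
  is_resolvent mu E a f u -> is_subgradient u (f \- a \*o u).
Proof.
move=> a0 Lf Ru; have Eu := is_resolvent_form_lty a0 Lf Ru.
have [Lu _] := Ru; have Lau := L2_scale a Lu.
split=> // [|h Lh]; first exact: L2_sub.
have := is_resolvent_quadratic_growth a0 Lf Lh Ru.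
rewrite !proximalE// (proximal_quad_expansion a Lf Lh Lu).
rewrite -(form_fineK nopfE Lu Eu) -!EFinD.
case: (E h) (nopf_ge0 nopfE Lh) => [r| |]// _; last by move=> _; exact: leey.
by rewrite -EFinD !lee_fin; lra.
Qed.

Lemma subgradient_is_resolvent a f u : 0 < a -> L2 mu f ->
  is_subgradient u (f \- a \*o u) -> is_resolvent mu E a f u.
Proof.
move=> a0 Lf [Lu _ Eu sub_u]; split => // h Lh.
rewrite -!/(proximal a f _) !proximalE// (proximal_quad_expansion a Lf Lh Lu).
have := sub_u _ Lh; rewrite -(form_fineK nopfE Lu Eu) -!EFinD.
have : 0 <= a / 2 * norm (h \- u) ^+ 2.
  by rewrite mulr_ge0 ?sqr_ge0// divr_ge0// ltW.
case: (E h) (nopf_ge0 nopfE Lh) => [r| |]// _ dist_ge0; last first.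
  by move=> _; rewrite addye// leey.
by rewrite -EFinD !lee_fin; lra.
Qed.

Lemma is_resolvent0 a : 0 < a -> is_resolvent mu E a (fun=> 0) (fun=> 0).
Proof.
move=> a0; apply: subgradient_is_resolvent => //; first exact: L2_0.
have := is_subgradient0 nopfE; congr is_subgradient.
by apply/funext => x /=; ring.
Qed.

Lemma is_resolvent_shift a b f u : 0 < a -> 0 < b -> L2 mu f ->
  is_resolvent mu E a f u -> is_resolvent mu E b (f \- (a - b) \*o u) u.
Proof.
move=> a0 b0 Lf Ru; have Lu : L2 mu u by case: Ru.
apply: subgradient_is_resolvent => //; first exact/L2_sub/L2_scale.
have := is_resolvent_subgradient a0 Lf Ru; congr is_subgradient.
by apply/funext => x /=; ring.
Qed.

Lemma resolvent_contraction a f1 f2 u1 u2 : 0 < a -> L2 mu f1 -> L2 mu f2 ->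
  is_resolvent mu E a f1 u1 -> is_resolvent mu E a f2 u2 ->
  a * norm (u1 \- u2) <= norm (f1 \- f2).
Proof.
move=> a0 Lf1 Lf2 Ru1 Ru2; have [Lu1 _] := Ru1; have [Lu2 _] := Ru2.
have Lf := L2_sub Lf1 Lf2; have Lu := L2_sub Lu1 Lu2; have Lau := L2_scale a Lu.
have := subgradient_monotone nopfE (is_resolvent_subgradient a0 Lf1 Ru1)
  (is_resolvent_subgradient a0 Lf2 Ru2).
have -> : (f1 \- a \*o u1) \- (f2 \- a \*o u2) =
    (f1 \- f2) \- a \*o (u1 \- u2) by apply/funext => x /=; ring.
rewrite dotL2Bl// dotL2Zl// dotL2ff// => mono.
have [->|norm_neq0] := eqVneq (norm (u1 \- u2)) 0.
  by rewrite mulr0 normL2_ge0.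
have norm_gt0 : 0 < norm (u1 \- u2).
  by rewrite lt_neqAle eq_sym norm_neq0 normL2_ge0.
rewrite -(ler_pM2r norm_gt0); apply: le_trans (CauchySchwarz_L2 Lf Lu).
by apply: le_trans (ler_norm _); lra.
Qed.

Lemma resolvent_le a f1 f2 u1 u2 : 0 < a -> L2 mu f1 -> L2 mu f2 ->
  {ae mu, forall x, f1 x <= f2 x} ->
  is_resolvent mu E a f1 u1 -> is_resolvent mu E a f2 u2 ->
  {ae mu, forall x, u1 x <= u2 x}.
Proof.
move=> a0 Lf1 Lf2 f12 Ru1 Ru2; have [Lu1 _] := Ru1; have [Lu2 _] := Ru2.
pose q := (u1 \- u2)^\+.
have Lu := L2_sub Lu1 Lu2; have Lq : L2 mu q := L2_funrpos Lu.
have Lf := L2_sub Lf2 Lf1; have Lau := L2_scale a Lu.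
have := subgradient_T_monotone nopfE (is_resolvent_subgradient a0 Lf1 Ru1)
  (is_resolvent_subgradient a0 Lf2 Ru2).
have -> : (f1 \- a \*o u1) \- (f2 \- a \*o u2) =
    (-1 \*o (f2 \- f1)) \- a \*o (u1 \- u2) by apply/funext => x /=; ring.
rewrite -/q dotL2Bl//; last exact: L2_scale.
rewrite !dotL2Zl//.
have -> : dot (u1 \- u2) q = dot q q.
  apply: eq_Rintegral => x _; rewrite /q /funrpos/=.
  by have [] := leP (u1 x - u2 x) 0; nra.
have : 0 <= dot (f2 \- f1) q.
  apply: dotL2_ge0; [exact: L2_measurable Lf|exact: L2_measurable Lq|].
  apply: filterS f12 => x f12x.
  by rewrite mulr_ge0 ?subr_ge0 ?funrpos_ge0.
rewrite dotL2ff// => f_ge0 T_mono.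
have norm_q0 : norm q = 0.
  by apply/eqP; rewrite -sqrf_eq0 eq_le sqr_ge0 andbT -(pmulr_rle0 _ a0); lra.
apply: filterS (normL2_eq0 Lq norm_q0) => x; rewrite /q /funrpos/=.
by have [] := leP (u1 x - u2 x) 0; lra.
Qed.

Lemma resolvent_ge0 a f u : 0 < a -> L2 mu f -> {ae mu, forall x, 0 <= f x} ->
  is_resolvent mu E a f u -> {ae mu, forall x, 0 <= u x}.
Proof.
move=> a0 Lf f0; apply: (resolvent_le a0 _ _ f0 (is_resolvent0 a0)) => //.
exact: L2_0.
Qed.

Lemma resolvent_antitone a b f ua ub : 0 < b -> b <= a -> L2 mu f ->
  {ae mu, forall x, 0 <= f x} ->
  is_resolvent mu E a f ua -> is_resolvent mu E b f ub ->
  {ae mu, forall x, ua x <= ub x}.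
Proof.
move=> b0 ba Lf f0 Ra Rb; have a0 : 0 < a by exact: lt_le_trans ba.
have Lua : L2 mu ua by case: Ra.
apply: (resolvent_le b0 _ Lf _ (is_resolvent_shift a0 b0 Lf Ra) Rb).
  exact/L2_sub/L2_scale.
apply: filterS (resolvent_ge0 a0 Lf f0 Ra) => x ux.
by rewrite lerBlDr lerDl mulr_ge0// subr_ge0.
Qed.

End resolvent.

Section resolvent_existence.
Context {d : measure_display} {X : measurableType d} {R : realType}.
Variables (mu : {measure set X -> \bar R}) (E : (X -> R) -> \bar R).
Hypothesis nopfE : nonlinear_order_preserving_form mu E.
Implicit Types (p q u v : X -> R) (h : nat -> X -> R).
Variables (a : R) (f : X -> R).
Hypotheses (a0 : 0 < a) (Lf : L2 mu f).
Local Notation dot := (dotL2 mu).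
Local Notation norm := (normL2 mu).
Local Notation J := (proximal mu E a f).

Lemma proximal_ge0 u : L2 mu u -> (0 <= J u)%E.
Proof.
move=> Lu; apply: adde_ge0; first exact: (nopf_ge0 nopfE).
apply: mule_ge0; first by rewrite lee_fin divr_ge0// ltW.
by apply: integral_ge0 => x _; rewrite lee_fin sqr_ge0.
Qed.

Lemma proximal_near_minimizers_close (r e : R) p q : L2 mu p -> L2 mu q ->
  (forall u, L2 mu u -> (r%:E <= J u)%E) ->
  (J p <= (r + e)%:E)%E -> (J q <= (r + e)%:E)%E ->
  a / 8 * norm (p \- q) ^+ 2 <= e.
Proof.
move=> Lp Lq rmin Jp Jq.
have half01 : 0 <= (2^-1 : R) <= 1 by apply/andP; split; lra.
have Lm : L2 mu (2^-1 \*o p \+ (1 - 2^-1) \*o q).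
  by apply: L2_add; exact: L2_scale.
have := le_trans (leeD2r _ (rmin _ Lm))
  (proximal_strongly_convex nopfE a0 Lf Lp Lq half01).
have half_le (x : \bar R) c : 0 <= c -> (x <= (r + e)%:E)%E ->
    (c%:E * x <= (c * (r + e))%:E)%E.
  by move=> c0 xr; rewrite EFinM lee_wpmul2l ?lee_fin.
move=> /le_trans/(_ (leeD (half_le _ _ _ Jp) (half_le _ _ _ Jq))).
by rewrite -!EFinD lee_fin; lra.
Qed.

Lemma proximal_le_cvg h u (s : R^nat) (r : R) :
  (forall n, L2 mu (h n)) -> L2 mu u ->
  norm (h n \- u) @[n --> \oo] --> 0 ->
  (forall n, (J (h n) <= (s n)%:E)%E) -> s @ \oo --> r -> (J u <= r%:E)%E.
Proof.
move=> Lh Lu hu Js sr.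
pose Q := proximal_quad mu a f.
have QE v : L2 mu v -> J v = (E v + (Q v)%:E)%E by exact: proximalE.
have Qcvg : Q (h n) @[n --> \oo] --> Q u.
  apply: cvgD; last exact: cvg_cst.
  apply: cvgB; last exact: dotL2_cvg.
  by apply: cvgM; [exact: cvg_cst|exact: sqr_normL2_cvg].
rewrite QE// -leeBrDr// -EFinB.
apply: le_trans (nopf_lsc nopfE Lh Lu _) _.
  under eq_fun do rewrite dist2E//.
  apply: cvg_EFin; first exact: nearW.
  by rewrite -[X in _ --> X](mulr0 0); exact: (cvgM hu hu).
apply: (limn_einf_le_cvg (v := fun n => (s n - Q (h n))%:E)) => [n|].
  by rewrite EFinB leeBrDr// -QE.
by apply: cvg_EFin; [exact: nearW|exact: cvgB].
Qed.

Lemma resolvent_exists : exists u, is_resolvent mu E a f u.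
Proof.
pose r := fine (ereal_inf [set J u | u in L2 mu]).
have rE : ereal_inf [set J u | u in L2 mu] = r%:E.
  rewrite fineK// ge0_fin_numE; last first.
    by apply: le_ereal_inf_tmp => _ [u Lu <-]; exact: proximal_ge0.
  apply: (@le_lt_trans _ _ (J (fun=> 0))).
    by apply: ereal_inf_lbound; exists (fun=> 0) => //; exact: L2_0.
  by rewrite proximalE//; [rewrite (nopf_0 nopfE) add0e ltry|exact: L2_0].
have rmin u : L2 mu u -> (r%:E <= J u)%E.
  by move=> Lu; rewrite -rE; apply: ereal_inf_lbound; exists u.
have /choice[h /all_and2[Lh hJ]] : forall n, exists u,
    L2 mu u /\ (J u <= (r + harmonic n)%:E)%E.
  move=> n; have : (ereal_inf [set J u | u in L2 mu] < (r + harmonic n)%:E)%E.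
    by rewrite rE lte_fin ltrDl harmonic_gt0.
  by move=> /ereal_inf_lt[_ [u Lu <-] /ltW]; exists u.
have [u Lu hu] : exists2 u, L2 mu u & norm (h n \- u) @[n --> \oo] --> 0.
  apply: L2_complete => // e e0.
  have tol_gt0 : 0 < a / 8 * e ^+ 2 by rewrite mulr_gt0 ?divr_gt0 ?exprn_gt0.
  have [N _ /(_ N (leqnn N))/ltW Ne] := near_infty_natSinv_lt (PosNum tol_gt0).
  exists N => n m Nn Nm.
  have JN k : (N <= k)%N -> (J (h k) <= (r + a / 8 * e ^+ 2)%:E)%E.
    move=> Nk; apply: le_trans (hJ k) _; rewrite lee_fin lerD2l.
    by apply: le_trans Ne; rewrite /= lef_pV2 ?posrE// ler_nat.
  have := proximal_near_minimizers_close (Lh n) (Lh m) rmin (JN n Nn) (JN m Nm).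
  by rewrite ler_pM2l ?divr_gt0// ler_sqr ?nnegrE ?normL2_ge0// ltW.
exists u; split => // v Lv; rewrite -!/(proximal mu E a f _).
apply: le_trans (rmin v Lv); apply: (proximal_le_cvg Lh Lu hu hJ).
rewrite -[X in _ --> X]addr0.
by apply: cvgD; [exact: cvg_cst|exact: cvg_harmonic].
Qed.

End resolvent_existence.

Section resolvent_operator.
Context {d : measure_display} {X : measurableType d} {R : realType}.
Variables (mu : {measure set X -> \bar R}) (E : (X -> R) -> \bar R).

Definition resolvent (a : R) (f : X -> R) : X -> R :=
  xget (fun=> 0) (is_resolvent mu E a f).

Lemma resolventP a f : nonlinear_order_preserving_form mu E ->
  0 < a -> L2 mu f -> is_resolvent mu E a f (resolvent a f).
Proof. by move=> nopfE a0 Lf; apply: xgetPex; exact: resolvent_exists. Qed.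

End resolvent_operator.

(** * Weights and the Luxemburg seminorm *)

Section sigma_finite_weight.
Context {d : measure_display} {X : measurableType d} {R : realType}.
Variable mu : {measure set X -> \bar R}.

Lemma integral_nneseries_indic (c : R^nat) (F : (set X)^nat) :
  (forall n, 0 <= c n) -> (forall n, measurable (F n)) ->
  (\int[mu]_x (\sum_(n <oo) (c n * \1_(F n) x)%:E) =
   \sum_(n <oo) (c n)%:E * mu (F n))%E.
Proof.
move=> c0 mF.
rewrite integral_nneseries//; last 2 first.
- by move=> n; exact/measurable_EFinP/measurable_funM.
- by move=> n x _; rewrite lee_fin mulr_ge0.
apply: eq_eseriesr => n _; under eq_integral do rewrite EFinM.
rewrite ge0_integralZl_EFin//; first by rewrite integral_indic// setIT.
exact/measurable_EFinP/measurable_indic.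
Qed.

Lemma nneseries_indic_itv (c : R^nat) (F : (set X)^nat) x :
  (forall n, 0 < c n <= 1 / (2 ^ n.+1)%:R) -> setT = \bigcup_n F n ->
  (0 < \sum_(n <oo) (c n * \1_(F n) x)%:E <= 1)%E.
Proof.
move=> c_itv TF; pose t n : \bar R := (c n * \1_(F n) x)%:E.
have t0 n : (0 <= t n)%E.
  by rewrite lee_fin mulr_ge0//; case/andP: (c_itv n) => /ltW.
apply/andP; split.
  have [n _ Fnx] : (\bigcup_n F n) x by rewrite -TF.
  apply: (@lt_le_trans _ _ (t n)).
    by rewrite lte_fin indicE mem_set// mulr1; case/andP: (c_itv n).
  apply: le_trans (@nneseries_lim_ge _ t xpredT 0 n.+1 _) => //.
  by rewrite big_nat_recr//= leeDr// sume_ge0.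
apply: le_trans (@epsilon_trick0 R 1 xpredT ler01).
apply: lee_nneseries => [n _ _|n _]; first exact: t0.
have /andP[c0 c_le] := c_itv n.
rewrite lee_fin; apply: le_trans c_le.
by rewrite ger_pMr// indicE; case: (_ \in _).
Qed.

Lemma sigma_finite_weight : sigma_finite setT mu ->
  exists phi : X -> R, [/\ measurable_fun setT phi, (forall x, 0 < phi x <= 1) &
    (\int[mu]_x (phi x)%:E <= 1)%E].
Proof.
move=> [F TF /all_and2[mF Ffin]]; pose m n := fine (mu (F n)).
have muF n : mu (F n) = (m n)%:E by rewrite fineK// ge0_fin_numE.
have m0 n : 0 <= m n by rewrite -lee_fin -muF.
pose c n : R := 1 / (2 ^ n.+1)%:R / (1 + m n).
have c0 n : 0 < c n by rewrite !divr_gt0 ?ltr0n ?expn_gt0// ltr_wpDr.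
have cM_le n (y : R) : y <= 1 + m n -> c n * y <= 1 / (2 ^ n.+1)%:R.
  move=> y_le; rewrite mulrAC ler_pdivrMr ?ltr_wpDr//.
  by rewrite ler_pM2l// divr_gt0// ltr0n expn_gt0.
have c_itv n : 0 < c n <= 1 / (2 ^ n.+1)%:R.
  by rewrite c0/= -[leLHS]mulr1 cM_le// lerDl.
pose psi x : \bar R := (\sum_(n <oo) (c n * \1_(F n) x)%:E)%E.
have psi_itv x : (0 < psi x <= 1)%E by exact: nneseries_indic_itv.
have psiE x : (fine (psi x))%:E = psi x.
  have /andP[psi0 psi1] := psi_itv x.
  by rewrite fineK// ge0_fin_numE ?(le_lt_trans psi1) ?ltry// ltW.
exists (fine \o psi); split => /= [|x|].
- apply: measurableT_comp => //.
  apply: (@ge0_emeasurable_sum _ _ _ _ _ xpredT) => n *.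
    by rewrite lee_fin mulr_ge0// ltW.
  exact/measurable_EFinP/measurable_funM.
- by rewrite -lte_fin -lee_fin psiE.
under eq_integral do rewrite psiE.
rewrite integral_nneseries_indic//; last by move=> n; exact: ltW.
apply: le_trans (@epsilon_trick0 R 1 xpredT ler01).
apply: lee_nneseries => n _; first by rewrite mule_ge0// lee_fin ltW.
by rewrite muF lee_fin cM_le// lerDr.
Qed.

Lemma exists_L2_minorant (g : X -> R) : sigma_finite setT mu ->
  measurable_fun setT g -> (forall x, 0 < g x) ->
  exists h : X -> R, [/\ L2 mu h, (forall x, 0 < h x <= g x) &
    (\int[mu]_x (h x)%:E <= 1)%E].
Proof.
move=> /sigma_finite_weight[phi [mphi phi01 iphi]] mg g0.
have phi0 x : 0 < phi x by case/andP: (phi01 x).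
pose h x := Num.min (g x) (phi x).
have h0 x : 0 < h x by rewrite lt_min g0 phi0.
have h1 x : h x <= 1.
  by rewrite ge_min; case/andP: (phi01 x) => _ ->; rewrite orbT.
have mh : measurable_fun setT h by exact: measurable_minr.
have ih : (\int[mu]_x (h x)%:E <= 1)%E.
  apply: le_trans iphi; apply: ge0_le_integral => //.
  - by move=> x _; rewrite lee_fin ltW.
  - exact/measurable_EFinP.
  - exact/measurable_EFinP.
  - by move=> x _; rewrite lee_fin ge_min lexx orbT.
exists h; split=> // [|x]; last by rewrite h0 ge_min lexx.
split => //; apply: le_lt_trans (ltry 1); apply: le_trans ih.
apply: ge0_le_integral => //.
- by move=> x _; rewrite lee_fin sqr_ge0.
- exact/measurable_EFinP/measurable_funX.
- exact/measurable_EFinP.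
- by move=> x _; rewrite lee_fin expr2 ger_pMr.
Qed.

End sigma_finite_weight.

Section luxemburg_weight.
Context {d : measure_display} {X : measurableType d} {R : realType}.
Variables (mu : {measure set X -> \bar R}) (E : (X -> R) -> \bar R).
Hypothesis nopfE : nonlinear_order_preserving_form mu E.
Implicit Types f w : X -> R.

Lemma measurable_norm_mul f w :
  measurable_fun setT f -> measurable_fun setT w ->
  measurable_fun setT (fun x => `|f x| * w x).
Proof.
by move=> mf mw; apply: measurable_funM => //; exact: measurableT_comp.
Qed.

Definition luxemburg_weight w : Prop := forall f, modular_space (L2 mu) E f ->
  (\int[mu]_x (`|f x| * w x)%:E <= luxemburg E f)%E.

Lemma modular_space_lty f : L2 mu f -> (E f < +oo)%E ->
  modular_space (L2 mu) E f.
Proof.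
move=> Lf Ef; split => //; have EfE := form_fineK nopfE Lf Ef.
apply: (@squeeze_cvge _ _ _ _ (fun=> 0%E) _ (fun t => (t * fine (E f))%:E)).
- near=> t; have t0 : 0 < t by near: t; exact: nbhs_right_gt.
  have t1 : t <= 1 by near: t; exact: nbhs_right_le.
  rewrite (nopf_ge0 nopfE)/=; last exact: (L2_scale t Lf).
  by rewrite EFinM EfE; apply: (form_scale nopfE) => //; rewrite ltW.
- exact: cvg_cst.
- apply: cvg_EFin; first exact: nearW.
  rewrite -[X in _ --> X](mul0r (fine (E f))); apply: cvgM; last exact: cvg_cst.
  exact: cvg_at_right_filter cvg_id.
Unshelve. all: by end_near. Qed.

Lemma luxemburg_le f : L2 mu f -> (luxemburg E f <= maxe 1 (E f))%E.
Proof.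
move=> Lf; have [Ef|] := ltP (E f) +oo%E; last first.
  by rewrite leye_eq => /eqP ->; rewrite maxey leey.
rewrite -(form_fineK nopfE Lf Ef) -EFin_max; set l := Num.max _ _.
have l1 : 1 <= l by rewrite le_max lexx.
have l0 : 0 < l by exact: lt_le_trans l1.
apply: ereal_inf_lbound; exists l => //=; split => //.
apply: le_trans (form_scale nopfE Lf _) _.
  by rewrite invr_ge0 ltW//= invf_le1.
rewrite -(form_fineK nopfE Lf Ef) -EFinM lee_fin mulrC ler_pdivrMr// mul1r.
by rewrite le_max lexx orbT.
Qed.

Lemma integral_le_luxemburg (F : (X -> R) -> \bar R) f w :
  measurable_fun setT f -> measurable_fun setT w -> (forall x, 0 <= w x) ->
  (forall l, (\int[mu]_x (`|l * f x| * w x)%:E <= maxe 1 (F (l \*o f)))%E) ->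
  (\int[mu]_x (`|f x| * w x)%:E <= luxemburg F f)%E.
Proof.
move=> mf mw w0 intF; apply: le_ereal_inf_tmp => _ [l [l0 Fl] <-].
have : (\int[mu]_x (`|l^-1 * f x| * w x)%:E <= 1)%E.
  by apply: le_trans (intF l^-1) _; rewrite ge_max lexx.
under eq_integral do rewrite normrM -mulrA EFinM.
rewrite ge0_integralZl_EFin//; last 2 first.
- by move=> x _; rewrite lee_fin mulr_ge0.
- exact/measurable_EFinP/measurable_norm_mul.
by rewrite gtr0_norm ?invr_gt0// lee_pdivrMl// mule1.
Qed.

Lemma luxemburg_weightP w : measurable_fun setT w -> (forall x, 0 <= w x) ->
  luxemburg_weight w <->
  forall f, L2 mu f -> (\int[mu]_x (`|f x| * w x)%:E <= maxe 1 (E f))%E.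
Proof.
move=> mw w0; split=> [lux_w f Lf|int_le f [Lf _]].
- have [Ef|] := ltP (E f) +oo%E; last first.
    by rewrite leye_eq => /eqP ->; rewrite maxey leey.
  exact: le_trans (lux_w _ (modular_space_lty Lf Ef)) (luxemburg_le Lf).
- apply: integral_le_luxemburg => // [|l]; first exact: L2_measurable Lf.
  exact: (int_le _ (L2_scale l Lf)).
Qed.

End luxemburg_weight.

Section extended_form.
Context {d : measure_display} {X : measurableType d} {R : realType}.
Variables (mu : {measure set X -> \bar R}) (E : (X -> R) -> \bar R).
Hypothesis sigma_finite_mu : sigma_finite setT mu.
Implicit Types f w : X -> R.

Lemma loc_cvg_meas_ae_subseq (h : nat -> X -> R) f (P : set nat) :
  (forall n, measurable_fun setT (h n)) -> measurable_fun setT f ->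
  loc_cvg_meas mu h f -> (forall k, exists2 n, (k <= n)%N & P n) ->
  exists2 s : nat -> nat, (forall k, P (s k)) &
    {ae mu, forall x, (fun k => h (s k) x) @ \oo --> f x}.
Proof.
move=> mh mf hf Pfreq.
have /sigma_finiteP[F [TF ndF /all_and2[mF Ffin]]] := sigma_finite_mu.
pose B k n := F k `&` [set x | 2^-1 ^+ k <= `|h n x - f x|].
have /choice[s /all_and2[Ps muB]] : forall k, exists n,
    P n /\ (mu (B k n) <= (2^-1 ^+ k)%:E)%E.
  move=> k; have half_k_gt0 : 0 < (2^-1 : R) ^+ k by rewrite exprn_gt0.
  have [N _ BN] : \forall n \near \oo, (mu (B k n) <= (2^-1 ^+ k)%:E)%E.
    have /fine_cvgP[muB_fin /cvgr0Pnorm_lt/(_ _ half_k_gt0)] :=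
      hf _ (mF k) (Ffin k) _ half_k_gt0.
    apply: filterS2 muB_fin => n /= muB_fin muB_lt.
    rewrite -(fineK muB_fin) lee_fin.
    exact: le_trans (ler_norm _) (ltW muB_lt).
  by have [n Nn Pn] := Pfreq N; exists n; split => //; exact: BN.
exists s => //.
have := ae_near_lt_geometric_half ndF (esym TF) mF
  (fun k => measurable_funB (mh (s k)) mf) muB.
apply: filterS => x hsx; apply/subr_cvg0/cvgr0Pnorm_lt => e e0.
have : (2^-1 : R) ^+ k @[k --> \oo] --> 0.
  by apply: cvg_expr; rewrite ger0_norm//; lra.
move=> /cvgr0Pnorm_lt/(_ e e0); apply: filterS2 hsx => k /ltW hk.
exact/le_lt_trans/(le_trans hk)/ler_norm.
Qed.

Lemma extended_form_integral_le w f :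
  measurable_fun setT w -> (forall x, 0 <= w x) -> measurable_fun setT f ->
  (forall g, L2 mu g -> (\int[mu]_x (`|g x| * w x)%:E <= maxe 1 (E g))%E) ->
  (\int[mu]_x (`|f x| * w x)%:E <= maxe 1 (extended_form mu E f))%E.
Proof.
move=> mw w0 mf intE.
have [Ef|] := ltP (extended_form mu E f) +oo%E; last first.
  by rewrite leye_eq => /eqP ->; rewrite maxey leey.
set y := maxe _ _; have y1 : (1 <= y)%E by rewrite le_max lexx.
have y_fin : y \is a fin_num.
  by rewrite ge0_fin_numE ?(le_trans _ y1)// gt_max ltry.
apply/lee_addgt0Pr => e e0.
have /ereal_inf_lt[_ [h [Lh hf] <-] Eh] : (extended_form mu E f < y + e%:E)%E.
  by apply: (@le_lt_trans _ _ y); rewrite ?le_max ?lexx ?orbT// lteDl.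
have mh n := L2_measurable (Lh n).
have [s Es sf] := loc_cvg_meas_ae_subseq mh mf hf (limn_einf_lt_frequently Eh).
apply: (ae_cvg_integral_le (f := fun k x => (`|h (s k) x| * w x)%:E)).
- by move=> k; exact/measurable_EFinP/measurable_norm_mul.
- exact/measurable_EFinP/measurable_norm_mul.
- by move=> k x; rewrite lee_fin mulr_ge0.
- by move=> x; rewrite lee_fin mulr_ge0.
- apply: filterS sf => x sfx; apply: cvg_EFin; first exact: nearW.
  by apply: cvgM; [exact: cvg_norm|exact: cvg_cst].
- move=> k; apply: le_trans (intE _ (Lh (s k))) _.
  by rewrite ge_max (ltW (Es k)) (le_trans y1)// leeDl// lee_fin ltW.
Qed.

Lemma luxemburg_weight_extended w f : nonlinear_order_preserving_form mu E ->
  measurable_fun setT w -> (forall x, 0 <= w x) -> luxemburg_weight mu E w ->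
  measurable_fun setT f ->
  (\int[mu]_x (`|f x| * w x)%:E <= luxemburg (extended_form mu E) f)%E.
Proof.
move=> nopfE mw w0 /(luxemburg_weightP nopfE mw w0) intE mf.
apply: integral_le_luxemburg => // l; apply: extended_form_integral_le => //.
exact: measurable_funM.
Qed.

End extended_form.

(** * The Green operator *)

Section green_operator.
Context {d : measure_display} {X : measurableType d} {R : realType}.
Variables (mu : {measure set X -> \bar R}) (E : (X -> R) -> \bar R).
Hypothesis nopfE : nonlinear_order_preserving_form mu E.
Implicit Types (f u w : X -> R) (a : R).
Local Notation dot := (dotL2 mu).
Local Notation norm := (normL2 mu).
Local Notation G := (resolvent mu E).

Lemma resolvent_energy a f u : 0 < a -> L2 mu f -> is_resolvent mu E a f u ->
  (E u + (a * norm u ^+ 2)%:E <= (dot f u)%:E)%E.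
Proof.
move=> a0 Lf Ru; have [Lu _] := Ru; have Lau := L2_scale a Lu.
have := subgradient_form_le nopfE (is_resolvent_subgradient nopfE a0 Lf Ru).
by rewrite dotL2Bl// dotL2Zl// dotL2ff// EFinB leeBrDr.
Qed.

Lemma resolvent_monotone_cvg a f u (fn gn : nat -> X -> R) : 0 < a ->
  L2 mu f -> is_resolvent mu E a f u ->
  (forall n, L2 mu (fn n)) -> (forall n x, 0 <= fn n x <= fn n.+1 x) ->
  (forall x, fn ^~ x @ \oo --> f x) ->
  (forall n, is_resolvent mu E a (fn n) (gn n)) ->
  {ae mu, forall x, gn ^~ x @ \oo --> u x}.
Proof.
move=> a0 Lf Ru Lfn fnS fnf Rgn.
have fn_le n x : fn n x <= f x.
  rewrite -(cvg_lim _ (fnf x))//; apply: nondecreasing_cvgn_le.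
    by apply/nondecreasing_seqP => k; case/andP: (fnS k x).
  by apply/cvg_ex; exists (f x).
have fn_cvg : norm (fn n \- f) @[n --> \oo] --> 0.
  apply: (L2_dominated_cvg Lfn Lf Lf fnf) => n x.
  have /andP[fn_ge0 _] := fnS n x.
  by rewrite distrC ger0_norm ?subr_ge0// lerBlDr lerDl.
apply: ae_nondecreasing_L2_cvg.
- by move=> n; case: (Rgn n).
- by case: Ru.
- move=> n.
  apply: (resolvent_le nopfE a0 (Lfn n) (Lfn n.+1) _ (Rgn n) (Rgn n.+1)).
  by apply: aeW => x; case/andP: (fnS n x).
- move=> n; apply: (resolvent_le nopfE a0 (Lfn n) Lf _ (Rgn n) Ru).
  by apply: aeW => x; exact: fn_le.
apply: (@squeeze_cvgr _ _ _ _ (fun=> 0) (fun n => a^-1 * norm (fn n \- f))).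
- apply: nearW => n; rewrite normL2_ge0/= ler_pdivlMl//.
  exact: (resolvent_contraction nopfE a0 (Lfn n) Lf (Rgn n) Ru).
- exact: cvg_cst.
- by rewrite -[X in _ --> X](mulr0 a^-1); apply: cvgM => //; exact: cvg_cst.
Qed.

Section green_of_L2.
Variable g : X -> R.
Hypotheses (Lg : L2 mu g) (g0 : forall x, 0 <= g x).

Definition green x : \bar R :=
  ereal_sup (range (fun k => (G (harmonic k) g x)%:E)).

Lemma resolvent_antitone_seq (a b : R^nat) : (forall n, 0 < a n) ->
  {ae mu, forall x n k, a n <= b k -> G (b k) g x <= G (a n) g x}.
Proof.
move=> a0; apply/ae_foralln => n; apply/ae_foralln => k.
have [ab|/negP ab] := boolP (a n <= b k); last exact: aeW.
have b0 : 0 < b k by exact: lt_le_trans ab.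
have Ra := resolventP nopfE (a0 n) Lg; have Rb := resolventP nopfE b0 Lg.
by apply: filterS (resolvent_antitone nopfE (a0 n) ab Lg (aeW _ g0) Rb Ra) => x.
Qed.

Lemma resolvent_harmonic_nondecreasing :
  {ae mu, forall x, nondecreasing_seq (fun k => G (harmonic k) g x)}.
Proof.
apply: filterS (resolvent_antitone_seq harmonic harmonic_gt0) => x anti m n mn.
by apply: anti; rewrite /= lef_pV2 ?posrE// ler_nat.
Qed.

Lemma is_green_green : is_green mu E (EFin \o g) green.
Proof.
exists (fun a x => (G a g x)%:E).
split=> [a a0 fn gn Lfn fnS fnf Rgn|b b0 bcvg].
  have fnf' x : fn ^~ x @ \oo --> g x by have /fine_cvgP[] := fnf x.
  have Rg := resolventP nopfE a0 Lg.
  have := resolvent_monotone_cvg a0 Lg Rg Lfn fnS fnf' Rgn.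
  by apply: filterS => x gnx; apply: cvg_EFin; first exact: nearW.
apply: filterS2 (resolvent_antitone_seq harmonic b0)
  (resolvent_antitone_seq b harmonic_gt0) => x le_b ge_b.
apply: cvg_ereal_sup_range => [k|n].
  have /cvgr0Pnorm_lt/(_ _ (harmonic_gt0 k)) := bcvg.
  apply: filterS => n bn; rewrite lee_fin le_b//.
  exact: le_trans (ler_norm _) (ltW bn).
have [k _ /(_ k (leqnn k))/ltW cb] := near_infty_natSinv_lt (PosNum (b0 n)).
apply: le_ereal_sup_tmp; exists (G (harmonic k) g x)%:E; first by exists k.
by rewrite lee_fin ge_b.
Qed.

Lemma resolvent_weight_bound a w : 0 < a -> measurable_fun setT w ->
  luxemburg_weight mu E w -> (forall x, g x <= w x / 2) ->
  (\int[mu]_x (`|G a g x| * w x)%:E <= 2%:E)%E.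
Proof.
move=> a0 mw lux_w gw; have Ru := resolventP nopfE a0 Lg.
set u := G a g in Ru *.
have [Lu _] := Ru; have w0 x : 0 <= w x by have := g0 x; have := gw x; lra.
have Eu := is_resolvent_form_lty nopfE a0 Lg Ru.
set I := (\int[mu]_x _)%E.
have I_ge0 : (0 <= I)%E by apply: integral_ge0 => x _; rewrite lee_fin mulr_ge0.
have I_le : (I <= 1 + E u)%E.
  apply: le_trans ((luxemburg_weightP nopfE mw w0).1 lux_w u Lu) _.
  by rewrite ge_max leeDl ?(nopf_ge0 nopfE)//= leeDr.
have dot_le_I : ((dot (2 \*o g) u)%:E <= I)%E.
  apply: dotL2_le_integral => //; first exact: L2_scale.
  - by apply: measurable_norm_mul => //; exact: L2_measurable Lu.
  - by move=> x; rewrite mulr_ge0.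
  - apply: aeW => x /=; rewrite normrM mulrC ler_wpM2l// ger0_norm ?mulr_ge0//.
    by have := gw x; lra.
have := resolvent_energy a0 Lg Ru; have := mulr_ge0 (ltW a0) (sqr_ge0 (norm u)).
move: I_ge0 I_le dot_le_I; rewrite -(form_fineK nopfE Lu Eu) dotL2Zl//.
by case: I => [r| |]//; rewrite -?EFinD !lee_fin; lra.
Qed.

Lemma green_lty w : measurable_fun setT w -> (forall x, 0 < w x) ->
  luxemburg_weight mu E w -> (forall x, g x <= w x / 2) ->
  {ae mu, forall x, (green x < +oo)%E}.
Proof.
move=> mw w0 lux_w gw; have harm_gt0 := @harmonic_gt0 R.
pose h k x := (`|G (harmonic k) g x| * w x)%:E.
have : {ae mu, forall x, (limn_einf (h ^~ x) < +oo)%E}.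
  apply: (@integral_bounded_limn_einf_lty _ _ _ _ _ 2) => [k|k x|k].
  - apply/measurable_EFinP/measurable_norm_mul => //.
    by have [/L2_measurable] := resolventP nopfE (harm_gt0 k) Lg.
  - by rewrite lee_fin mulr_ge0// ltW.
  - exact: resolvent_weight_bound.
apply: filterS2 resolvent_harmonic_nondecreasing => x nd hx.
have [M hM] : exists M, (limn_einf (h ^~ x) < M%:E)%E.
  case: (limn_einf _) hx => [r| |]// _.
    by exists (r + 1); rewrite lte_fin ltrDl.
  by exists 0; exact: ltNyr.
apply: le_lt_trans (ltry (M / w x)); apply: ge_ereal_sup => _ [k _ <-].
have [n kn] := limn_einf_lt_frequently hM k.
rewrite lte_fin -ltr_pdivlMr// lee_fin => /ltW; apply: le_trans.
exact: le_trans (nd _ _ kn) (ler_norm _).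
Qed.

End green_of_L2.
End green_operator.

Section weight_of_green.
Context {d : measure_display} {X : measurableType d} {R : realType}.
Variables (mu : {measure set X -> \bar R}) (E : (X -> R) -> \bar R).
Hypothesis nopfE : nonlinear_order_preserving_form mu E.
Hypothesis sigma_finite_mu : sigma_finite setT mu.
Implicit Types (f g h u w : X -> R) (a : R).
Local Notation dot := (dotL2 mu).
Local Notation norm := (normL2 mu).
Local Notation G := (resolvent mu E).

Lemma L2_nondecreasing_approx g h : measurable_fun setT g -> L2 mu h ->
  (forall x, 0 <= h x <= g x) ->
  exists fn : nat -> X -> R, [/\ forall n, L2 mu (fn n),
    forall n x, 0 <= fn n x <= fn n.+1 x, forall n x, h x <= fn n x &
    forall x, fn ^~ x @ \oo --> g x].
Proof.
move=> mg Lh hg.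
have mcst1 : measurable_fun [set: X] (fun=> 1 : R) by exact: measurable_cst.
have [phi [Lphi phi01 _]] :=
  exists_L2_minorant sigma_finite_mu mcst1 (fun=> ltr01).
have phi0 x : 0 < phi x by case/andP: (phi01 x).
have g0 x : 0 <= g x by have /andP[h0] := hg x; exact: le_trans.
pose fn n x := Num.max (h x) (Num.min (g x) (n%:R * phi x)).
have h_le n x : h x <= fn n x by rewrite le_max lexx.
have fn0 n x : 0 <= fn n x.
  by have /andP[h0 _] := hg x; exact: le_trans (h_le n x).
exists fn; split=> // [n|n x|x].
- have Lb : L2 mu (h \+ n%:R \*o phi) by apply/L2_add/L2_scale.
  apply: (L2_le _ Lb) => [|x].
    apply: measurable_maxr; first exact: L2_measurable Lh.
    apply: measurable_minr => //; apply: measurable_funM => //.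
    exact: L2_measurable Lphi.
  have /andP[h0 _] := hg x.
  have nphi0 : 0 <= n%:R * phi x by rewrite mulr_ge0// ltW.
  rewrite !ger0_norm// ?addr_ge0//= ge_max lerDl nphi0/= ge_min.
  by rewrite [X in _ || X]lerDr h0 orbT.
- have phiS : n%:R * phi x <= n.+1%:R * phi x by rewrite ler_pM2r// ler_nat.
  by rewrite fn0/= ge_max !le_max lexx/= le_min !ge_min lexx phiS !orbT.
- apply: cvg_near_cst; exists (Num.bound (g x / phi x)) => // n /= Nn.
  have gn : g x <= n%:R * phi x.
    rewrite -ler_pdivrMr//; apply: le_trans (ltW (archi_boundP _)) _.
      by rewrite divr_ge0// ltW.
    by rewrite ler_nat.
  by rewrite /fn (min_idPl gn); apply/max_idPr; case/andP: (hg x).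
Qed.

Lemma resolvent_le_resolvent_ext a g h u (v : X -> \bar R) : 0 < a ->
  measurable_fun setT g -> L2 mu h -> (forall x, 0 <= h x <= g x) ->
  is_resolvent_ext mu E a (EFin \o g) v -> is_resolvent mu E a h u ->
  {ae mu, forall x, (u x)%:E <= v x}%E.
Proof.
move=> a0 mg Lh hg ext_v Ru.
have [fn [Lfn fnS hfn fng]] := L2_nondecreasing_approx mg Lh hg.
have Rfn n := resolventP nopfE a0 (Lfn n).
have fngE x : (fun n => (fn n x)%:E) @ \oo --> (g x)%:E.
  by apply: cvg_EFin; [exact: nearW|exact: fng].
have /ae_foralln u_le : forall n, {ae mu, forall x, u x <= G a (fn n) x}.
  move=> n; apply: (resolvent_le nopfE a0 Lh (Lfn n) _ Ru (Rfn n)).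
  exact: aeW.
apply: filterS2 u_le (ext_v _ _ Lfn fnS fngE Rfn) => x ux vx.
by apply: cvge_ge vx; apply: nearW => n; rewrite lee_fin.
Qed.

Lemma resolvent_le_green a g h u (v : X -> \bar R) : 0 < a ->
  measurable_fun setT g -> L2 mu h -> (forall x, 0 <= h x <= g x) ->
  is_green mu E (EFin \o g) v -> is_resolvent mu E a h u ->
  {ae mu, forall x, (u x)%:E <= v x}%E.
Proof.
move=> a0 mg Lh hg [ext [ext_res ext_v]] Ru.
pose b n : R := a * harmonic n.
have b0 n : 0 < b n by rewrite mulr_gt0// harmonic_gt0.
have b_cvg : b @ \oo --> 0.
  rewrite -[X in _ --> X](mulr0 a).
  by apply: cvgM; [exact: cvg_cst|exact: cvg_harmonic].
have ba n : b n <= a by rewrite ger_pMr// /= invf_le1// ler1n.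
have h0 : {ae mu, forall x, 0 <= h x} by apply: aeW => x; case/andP: (hg x).
have /ae_foralln u_le : forall n,
    {ae mu, forall x, ((u x)%:E <= ext (b n) x)%E}.
  move=> n; have Rb := resolventP nopfE (b0 n) Lh.
  apply: filterS2 (resolvent_antitone nopfE (b0 n) (ba n) Lh h0 Ru Rb)
    (resolvent_le_resolvent_ext (b0 n) mg Lh hg (ext_res _ (b0 n)) Rb) => x uG.
  by apply: le_trans; rewrite lee_fin.
apply: filterS2 u_le (ext_v b b0 b_cvg) => x ux vx.
by apply: cvge_ge vx; exact: nearW.
Qed.

Lemma exists_L2_damping h (V : X -> R) : L2 mu h -> (forall x, 0 < h x) ->
  measurable_fun setT V ->
  exists k : X -> R, [/\ L2 mu k, forall x, 0 < k x <= h x &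
    forall x, k x * `|V x| <= h x].
Proof.
move=> Lh h0 mV; pose k x := h x * expR (- `|V x|).
have k_le x : k x <= h x.
  by rewrite ger_pMr// -[leRHS]expR0 ler_expR oppr_le0.
have k0 x : 0 < k x by rewrite mulr_gt0// expR_gt0.
exists k; split=> [|x|x]; last 2 first.
- by rewrite k0 k_le.
- rewrite -mulrA ger_pMr// mulrC expRN ler_pdivrMr ?expR_gt0// mul1r.
  by apply: le_trans (expR_ge1Dx _); rewrite lerDr.
apply: (L2_le _ Lh) => [|x]; last by rewrite !gtr0_norm.
apply: measurable_funM; first exact: L2_measurable Lh.
apply: measurableT_comp (@measurable_expR R) _.
by apply: measurableT_comp => //; exact: measurableT_comp.
Qed.

Definition green_energy_le1 w : Prop :=
  forall n, dot w (G (harmonic n) w) <= 1.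

Lemma exists_green_energy_le1 g (v : X -> \bar R) :
  measurable_fun setT g -> (forall x, 0 < g x) ->
  is_green mu E (EFin \o g) v -> {ae mu, forall x, (v x < +oo)%E} ->
  exists w, [/\ L2 mu w, forall x, 0 < w x & green_energy_le1 w].
Proof.
move=> mg g0 green_v vfin; have harm_gt0 := @harmonic_gt0 R.
have [h [Lh h_itv ih]] := exists_L2_minorant sigma_finite_mu mg g0.
have h0 x : 0 < h x by case/andP: (h_itv x).
have hg x : 0 <= h x <= g x by case/andP: (h_itv x) => /ltW -> ->.
have RU n := resolventP nopfE (harm_gt0 n) Lh.
have /ae_foralln U_le : forall n,
    {ae mu, forall x, ((G (harmonic n) h x)%:E <= v x)%E}.
  by move=> n; exact: (resolvent_le_green (harm_gt0 n) mg Lh hg green_v (RU n)).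
have [||V mV U_V] :=
  @ae_bounded_measurable_ubound _ _ _ mu (fun n => G (harmonic n) h).
- by move=> n; have [/L2_measurable] := RU n.
- apply: filterS2 U_le vfin => x.
  case: (v x) => [r| |]// Uv _; first by exists r => n; rewrite -lee_fin.
  by have := Uv 0%N; rewrite leNgt ltNyr.
have [w [Lw w_h wV]] := exists_L2_damping Lh h0 mV.
have w0 x : 0 < w x by case/andP: (w_h x).
have wh_ae : {ae mu, forall x, w x <= h x}.
  by apply: aeW => x; case/andP: (w_h x).
have w0_ae : {ae mu, forall x, 0 <= w x} by apply: aeW => x; exact: ltW.
exists w; split=> // n; have Rw := resolventP nopfE (harm_gt0 n) Lw.
have [LGw _] := Rw; rewrite -lee_fin; apply: le_trans ih.
apply: dotL2_le_integral => // [|x|]; [exact: L2_measurable Lh|exact: ltW|].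
apply: filterS3 (resolvent_le nopfE (harm_gt0 n) Lw Lh wh_ae Rw (RU n))
  (resolvent_ge0 nopfE (harm_gt0 n) Lw w0_ae Rw) U_V => x GwU Gw0 /(_ n) UV.
rewrite normrM gtr0_norm// ger0_norm//; apply: le_trans (wV x).
by rewrite ler_pM2l//; apply: le_trans GwU _; apply: le_trans UV (ler_norm _).
Qed.

Lemma green_energy_le1_dotL2_abs w f :
  L2 mu w -> green_energy_le1 w -> L2 mu f ->
  ((dot w (fun x => `|f x|)%R)%:E <= 1 + E f)%E.
Proof.
move=> Lw wG Lf; have [Ef|] := ltP (E f) +oo%E; last first.
  by rewrite leye_eq => /eqP ->; rewrite addey// leey.
pose F x := `|f x|; have LF : L2 mu F := L2_abs Lf.
have EF := le_lt_trans (form_abs nopfE Lf) Ef.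
rewrite -/F; apply: le_trans (leeD2l 1 (form_abs nopfE Lf)).
rewrite -/F -(form_fineK nopfE LF EF) -EFinD lee_fin -subr_ge0.
apply: (@harmonic_perturbation_ge0 _ _ (norm F ^+ 2 / 4)) => n.
have a0 : 0 < harmonic n :> R := harmonic_gt0 n.
have := wG n; move: (harmonic n) a0 => a a0; set u := G a w => wu.
have Ru : is_resolvent mu E a w u := resolventP nopfE a0 Lw.
have [Lu _ Eu /(_ _ LF)] := is_resolvent_subgradient nopfE a0 Lw Ru.
have Lau := L2_scale a Lu; have LF2 := L2_scale 2^-1 LF.
rewrite -(form_fineK nopfE Lu Eu) -(form_fineK nopfE LF EF) -EFinD lee_fin.
rewrite dotL2Br ?dotL2Bl ?dotL2Zl ?dotL2ff//; last exact: L2_sub.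
have Eu0 : 0 <= fine (E u) by rewrite fine_ge0// (nopf_ge0 nopfE).
have := mulr_ge0 (ltW a0) (sqr_ge0 (norm (u \- 2^-1 \*o F))).
by rewrite sqr_normL2B// -(dotL2ff LF2) dotL2Zl// !dotL2Zr// !dotL2ff//; lra.
Qed.

Lemma green_energy_le1_luxemburg_weight w :
  L2 mu w -> (forall x, 0 < w x) -> green_energy_le1 w ->
  luxemburg_weight mu E (fun x => w x / 2).
Proof.
move=> Lw w0 wG; have mw := L2_measurable Lw.
apply/(luxemburg_weightP nopfE) => [||f Lf]; first exact: measurable_funM.
  by move=> x; rewrite divr_ge0// ltW.
have := green_energy_le1_dotL2_abs Lw wG Lf.
rewrite -dotL2E//; last exact: L2_abs.
set I := (\int[mu]_x _)%E => I_le.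
have -> : (\int[mu]_x (`|f x| * (w x / 2))%:E = 2^-1%:E * I)%E.
  rewrite -ge0_integralZl_EFin//.
  - by apply: eq_integral => x _; rewrite -EFinM; congr EFin; ring.
  - by move=> x _; rewrite lee_fin mulr_ge0// ltW.
  - apply/measurable_EFinP/measurable_funM => //.
    exact: L2_measurable (L2_abs Lf).
move: I_le; have := nopf_ge0 nopfE Lf.
case: (E f) => [r| |]// _ I_le; last by rewrite maxey leey.
rewrite lee_pdivrMl//; apply: le_trans I_le _.
by rewrite -EFin_max -EFinM -EFinD lee_fin; have [] := leP 1 r; lra.
Qed.

Lemma green_lty_luxemburg_weight g (v : X -> \bar R) :
  measurable_fun setT g -> (forall x, 0 < g x) ->
  is_green mu E (EFin \o g) v -> {ae mu, forall x, (v x < +oo)%E} ->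
  exists w, [/\ measurable_fun setT w, forall x, 0 < w x &
    luxemburg_weight mu E w].
Proof.
move=> mg g0 green_v vfin.
have [w [Lw w0 wG]] := exists_green_energy_le1 mg g0 green_v vfin.
exists (fun x => w x / 2); split=> [|x|]; last 2 first.
- exact: divr_gt0.
- exact: green_energy_le1_luxemburg_weight.
by apply: measurable_funM => //; exact: L2_measurable Lw.
Qed.

Lemma luxemburg_weight_green_lty w :
  measurable_fun setT w -> (forall x, 0 < w x) -> luxemburg_weight mu E w ->
  exists g v, [/\ measurable_fun setT g, forall x, 0 < g x,
    is_green mu E (EFin \o g) v & {ae mu, forall x, (v x < +oo)%E}].
Proof.
move=> mw w0 lux_w; have mw2 : measurable_fun setT (fun x => w x / 2).
  exact: measurable_funM.
have w2_gt0 x : 0 < w x / 2 by exact: divr_gt0.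
have [g [Lg g_itv _]] := exists_L2_minorant sigma_finite_mu mw2 w2_gt0.
have g0 x : 0 < g x by case/andP: (g_itv x).
have g_ge0 x : 0 <= g x := ltW (g0 x).
exists g, (green mu E g); split=> //; first exact: L2_measurable Lg.
  exact: is_green_green.
by apply: (green_lty nopfE Lg g_ge0 mw w0 lux_w) => x; case/andP: (g_itv x).
Qed.

End weight_of_green.

Theorem theorem4p6 (d : measure_display) (X : measurableType d) (R : realType)
  (mu : {measure set X -> \bar R}) (E : (X -> R) -> \bar R) :
  sigma_finite setT mu ->
  nonlinear_order_preserving_form mu E ->
  ((exists g : X -> R, measurable_fun setT g /\ (forall x, 0 < g x) /\
      exists v, is_green mu E (fun x => (g x)%:E) v /\
                {ae mu, forall x, (v x < +oo)%E})
   <->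
   (exists w : X -> R, measurable_fun setT w /\ (forall x, 0 < w x) /\
      forall f, modular_space (L2 mu) E f ->
        (\int[mu]_x (`|f x| * w x)%:E <= luxemburg E f)%E))
  /\
  (extended_form_exists mu E ->
   forall w : X -> R, measurable_fun setT w -> (forall x, 0 < w x) ->
     (forall f, modular_space (L2 mu) E f ->
        (\int[mu]_x (`|f x| * w x)%:E <= luxemburg E f)%E) ->
     forall f, modular_space (@L0 _ _ R) (extended_form mu E) f ->
        (\int[mu]_x (`|f x| * w x)%:E <= luxemburg (extended_form mu E) f)%E).
Proof.
move=> sf nopfE; split; first split.
- move=> [g [mg [g0 [v [green_v v_lty]]]]].
  have [w [mw w0 lux_w]] :=
    green_lty_luxemburg_weight nopfE sf mg g0 green_v v_lty.
  by exists w.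
- move=> [w [mw [w0 lux_w]]].
  have [g [v [mg g0 green_v v_lty]]] :=
    luxemburg_weight_green_lty nopfE sf mw w0 lux_w.
  by exists g; do 2!split=> //; exists v.
- move=> _ w mw w0 lux_w f [mf _].
  by apply: luxemburg_weight_extended => // x; exact: ltW.
Qed.
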